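(* Suppose that the communication graph $\mathcal{G}$ is strongly connected and that the payoff functions $f_1,\dots,f_N$ satisfy (A2), (A3), (A4) of the context. Then there exists a scalar $\epsilon\in(0,\epsilon^* )$ such that, under periodically intermittent communication, i.e. $t_m=m\tilde T$ and $s_m=(m+\tilde\theta)\tilde T$ for $m=0,1,2,\dots$, with communication period $\tilde T>0$ and communication ratio $\tilde\theta\in(0,1)$ satisfying $$\mu_1\tilde\theta-\mu_2(1-\tilde\theta)>0,$$ the system (S) of the context has the exponentially stable equilibrium point $(\mathbf{x}^*,\mathbf{1}_N\otimes\mathbf{x}^* )$.
   Context: **Graph.** $\mathcal{G}=(\mathcal{N},\mathcal{E})$ is a directed graph on $\mathcal{N}=\{1,\dots,N\}$ without self-loops, with weighted adjacency matrix $\mathcal{A}=(a_{ij})$, where $a_{ij}>0$ if $(j,i)\in\mathcal{E}$ and $a_{ij}=0$ otherwise ($a_{ii}=0$). The Laplacian is $\mathcal{L}=\mathcal{D}-\mathcal{A}$, $\mathcal{D}=\mathrm{diag}\{d_1^{in},\dots,d_N^{in}\}$, $d_i^{in}=\sum_{j}a_{ij}$. Strongly connected: every node has a directed path to every other node. Let $\mathcal{B}=\mathrm{diag}\{a_{ij}\}$ be the $N^2\times N^2$ diagonal matrix with entries $a_{11},a_{12},\dots,a_{1N},a_{21},\dots,a_{NN}$. For $\mathcal{G}$ strongly connected it is known that there are positive definite $N^2\times N^2$ matrices $P$ (diagonal) and $Q$ with $(\mathcal{L}\otimes I_N+\mathcal{B})^{\top}P+P(\mathcal{L}\otimes I_N+\mathcal{B})=Q$;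 fix such $P,Q$. **Game.** Player $i$ has action $x_i\in\mathbb{R}$ and payoff $f_i(\mathbf{x})$, $\mathbf{x}=(x_1,\dots,x_N)^\top\in\mathbb{R}^N$, to be maximized over $x_i$. A Nash equilibrium is $\mathbf{x}^*=(x_i^*,\mathbf{x}_{-i}^* )$ with $f_i(x_i,\mathbf{x}^*_{-i})\le f_i(x_i^*,\mathbf{x}_{-i}^* )$ for all $x_i\in\mathbb{R}$, $i\in\mathcal{N}$, where $\mathbf{x}_{-i}$ collects the actions of the players other than $i$. Put $\frac{\partial G}{\partial\mathbf{x}}(\mathbf{x})=\big(\frac{\partial f_1}{\partial x_1}(\mathbf{x}),\dots,\frac{\partial f_N}{\partial x_N}(\mathbf{x})\big)^\top$. Assumptions: - (A2) each $f_i$ is twice continuously differentiable; - (A3) there is $\alpha>0$ with $\big|\frac{\partial f_i}{\partial x_i}(\mathbf{x})-\frac{\partial f_i}{\partial x_i}(\mathbf{z})\big|\le\alpha|\mathbf{x}-\mathbf{z}|$ for all $i$ and $\mathbf{x},\mathbf{z}\in\mathbb{R}^N$; - (A4) each $f_i$ is concave in $x_i$, and there is $\beta>0$ with $(\mathbf{x}-\mathbf{z})^\top\big(\frac{\partial G}{\partial\mathbf{x}}(\mathbf{x})-\frac{\partial G}{\partial\mathbf{x}}(\mathbf{z})\big)\le-\beta|\mathbf{x}-\mathbf{z}|^2$ for all $\mathbf{x},\mathbf{z}\in\mathbb{R}^N$. These guarantee a unique Nash equilibrium $\mathbf{x}^*$, and $\frac{\partial G}{\partial\mathbf{x}}(\mathbf{x})=\mathbf{0}$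 iff $\mathbf{x}=\mathbf{x}^*$. **System (S).** Let $0=t_0<s_0<t_1<s_1<\cdots$ with $t_m\to\infty$; $[t_m,s_m)$ is the $m$-th communication time and $[s_m,t_{m+1})$ the $m$-th silent time. Let $\bar k_i>0$ be constants and $\epsilon>0$. Player $i$ holds $\mathbf{y}_i=(y_{i1},\dots,y_{iN})^\top\in\mathbb{R}^N$ (its estimates of all actions), $\mathbf{y}=(\mathbf{y}_1^\top,\dots,\mathbf{y}_N^\top)^\top\in\mathbb{R}^{N^2}$. For all $i,j\in\mathcal{N}$: $$\dot x_i(t)=\epsilon\bar k_i\,\frac{\partial f_i}{\partial x_i}(\mathbf{y}_i(t)),$$ $$\dot y_{ij}(t)=-\Big(\sum_{k=1}^N a_{ik}(y_{ij}-y_{kj})+a_{ij}(y_{ij}-x_j)\Big)\ \text{for } t\in[t_m,s_m),\qquad \dot y_{ij}(t)=0\ \text{for } t\in[s_m,t_{m+1}).$$ **Constants.** It is known that under (A2)–(A4) there are a continuously differentiable function $\bar V$ and positive constants $\gamma_1,\dots,\gamma_5$ such that, with $\mathbf{e}=\mathbf{x}-\mathbf{x}^*$, for all $|\mathbf{e}|\le\gamma_5$: $\gamma_1|\mathbf{e}|^2\le\bar V(\mathbf{e})\le\gamma_2|\mathbf{e}|^2$, $\ \big(\frac{\partial\bar V}{\partial\mathbf{e}}\big)^\top\mathrm{diag}\{\bar k_i\}\frac{\partial G}{\partial\mathbf{x}}(\mathbf{x})\le-\gamma_3|\mathbf{e}|^2$, $\ \big|\frac{\partial\bar V}{\partial\mathbf{e}}\big|\le\gamma_4|\mathbf{e}|$.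 Fix these. Let $\Vert P\Vert$ be the induced norm and $\lambda_{\min},\lambda_{\max}$ the extreme eigenvalues. Put $$\pi_1=\alpha\max_i\{\bar k_i\}\big(\tfrac{\gamma_4}{2}+N\Vert P\Vert\big),\quad \pi_2=2\alpha\sqrt N\,\Vert P\Vert\max_i\{\bar k_i\},$$ $$\epsilon_1^*=\frac{\gamma_3\lambda_{\min}(Q)}{\gamma_3\pi_2+\pi_1^2},\quad \epsilon_2^*=\frac{\gamma_3^2\pi_2^2}{\pi_1^4},\quad \epsilon^*=\min\{\epsilon_1^*,\epsilon_2^*\},$$ $$\Gamma_1=\begin{pmatrix}\epsilon\gamma_3&-\epsilon\pi_1\\-\epsilon\pi_1&\lambda_{\min}(Q)-\epsilon\pi_2\end{pmatrix},\quad \Gamma_2=\begin{pmatrix}\sqrt\epsilon\,\gamma_3&\epsilon\pi_1\\ \epsilon\pi_1&\epsilon\pi_2\end{pmatrix}.$$ With $\mathbf{e}_{\mathbf{x}}=\mathbf{y}-\mathbf{1}_N\otimes\mathbf{x}$, let $V(\mathbf{e},\mathbf{e}_{\mathbf{x}})=\bar V(\mathbf{e})+\mathbf{e}_{\mathbf{x}}^\top P\mathbf{e}_{\mathbf{x}}$, and let $\eta_1,\eta_2>0$ be fixed constants with $\eta_1(|\mathbf{e}|^2+|\mathbf{e}_{\mathbf{x}}|^2)\le V\le\eta_2(|\mathbf{e}|^2+|\mathbf{e}_{\mathbf{x}}|^2)$ (for $|\mathbf{e}|\le\gamma_5$). Set $\mu_1=\lambda_{\min}(\Gamma_1)/\eta_2$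 and $\mu_2=\lambda_{\max}(\Gamma_2)/\eta_1$ (both depend on $\epsilon$). **Exponential stability** of an equilibrium $z^*$ of (S) means: there are $\delta,c,\lambda>0$ such that every solution $z(t)=(\mathbf{x}(t),\mathbf{y}(t))$ starting at $t=0$ with $|z(0)-z^*|<\delta$ satisfies $|z(t)-z^*|\le c|z(0)-z^*|e^{-\lambda t}$ for all $t\ge0$. *)

(* Defs.v *)
From HB Require Import structures.
From mathcomp Require Import all_boot all_order all_algebra.
From mathcomp Require Import all_classical all_reals all_analysis.
From mathcomp Require Import mxtens.

Set Implicit Arguments.
Unset Strict Implicit.
Unset Printing Implicit Defensive.

Import Order.TTheory GRing.Theory Num.Theory.
Import numFieldNormedType.Exports.

Local Open Scope classical_set_scope.
Local Open Scope ring_scope.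

(* The library norm `|v| on matrices is the sup norm, hence this definition. *)
Definition enorm {R : realType} {n : nat} (v : 'cV[R]_n) : R :=
  Num.sqrt (\sum_i v i ord0 ^+ 2).

Definition dotv {R : realType} {n : nat} (u v : 'cV[R]_n) : R :=
  \sum_i u i ord0 * v i ord0.

Definition opnorm {R : realType} {n : nat} (M : 'M[R]_n) : R :=
  sup [set enorm (M *m v) | v in [set v : 'cV[R]_n | enorm v = 1]].

(* Extreme eigenvalues; meant for symmetric matrices of positive size, whose
   set of real eigenvalues is finite and nonempty. *)
Definition lambda_min {R : realType} {n : nat} (M : 'M[R]_n) : R :=
  inf [set a | eigenvalue M a].

Definition lambda_max {R : realType} {n : nat} (M : 'M[R]_n) : R :=
  sup [set a | eigenvalue M a].

Definition posdef {R : realType} {n : nat} (M : 'M[R]_n) : Prop :=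
  M^T = M /\ forall v : 'cV[R]_n, v != 0 -> 0 < dotv v (M *m v).

Definition partial {R : realType} {n : nat} (i : 'I_n) (g : 'cV[R]_n -> R)
    (x : 'cV[R]_n) : R :=
  'D_(delta_mx i ord0) g x.

Definition grad {R : realType} {n : nat} (g : 'cV[R]_n -> R) (x : 'cV[R]_n) :
    'cV[R]_n :=
  \col_i partial i g x.

Definition is_C1 {R : realType} {n : nat} (g : 'cV[R]_n -> R) : Prop :=
  (forall i x, derivable g x (delta_mx i ord0)) /\
  (forall i, continuous (partial i g)).

Definition is_C2 {R : realType} {n : nat} (g : 'cV[R]_n -> R) : Prop :=
  is_C1 g /\ forall i, is_C1 (partial i g).

(* Derivative relative to D: two-sided at interior points of D, one-sided at an
   endpoint belonging to D. *)
Definition has_derivative_within {R : realType} (D : set R) (g : R -> R)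
    (t d : R) : Prop :=
  (fun u => (g u - g t) / (u - t)) @ within D (t^') --> d.

(* E j i is the edge from j to i, carrying the weight A i j. *)
Definition weighted_adjacency {R : realType} {N : nat} (E : rel 'I_N)
    (A : 'M[R]_N) : Prop :=
  forall i j, (E j i -> 0 < A i j) /\ (~~ E j i -> A i j = 0).

Definition strongly_connected {N : nat} (E : rel 'I_N) : Prop :=
  forall i j, connect E i j.

Definition laplacian {R : realType} {N : nat} (A : 'M[R]_N) : 'M[R]_N :=
  diag_mx (\row_i \sum_j A i j) - A.

(* Vectors and matrices of size N * N are indexed lexicographically by pairs
   (i, j) through mxtens_index, as Kronecker products are. *)
Definition diag_weights {R : realType} {N : nat} (A : 'M[R]_N) :
    'M[R]_(N * N) :=
  diag_mx (\row_k A (mxtens_unindex k).1 (mxtens_unindex k).2).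

Definition coupling {R : realType} {N : nat} (A : 'M[R]_N) : 'M[R]_(N * N) :=
  (laplacian A *t 1%:M) + diag_weights A.

Definition replicate {R : realType} {N : nat} (x : 'cV[R]_N) : 'cV[R]_(N * N) :=
  (const_mx 1 : 'cV[R]_N) *t x.

Definition est {R : realType} {N : nat} (y : 'cV[R]_(N * N)) (i j : 'I_N) : R :=
  y (mxtens_index (i, j)) ord0.

Definition est_vec {R : realType} {N : nat} (y : 'cV[R]_(N * N)) (i : 'I_N) :
    'cV[R]_N :=
  \col_j est y i j.

Definition set_action {R : realType} {N : nat} (x : 'cV[R]_N) (i : 'I_N)
    (a : R) : 'cV[R]_N :=
  \col_j (if j == i then a else x j ord0).

Definition nash_equilibrium {R : realType} {N : nat}
    (f : 'I_N -> 'cV[R]_N -> R) (xs : 'cV[R]_N) : Prop :=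
  forall i a, f i (set_action xs i a) <= f i xs.

Definition pseudograd {R : realType} {N : nat} (f : 'I_N -> 'cV[R]_N -> R)
    (x : 'cV[R]_N) : 'cV[R]_N :=
  \col_i partial i (f i) x.

Definition lipschitz_partials {R : realType} {N : nat}
    (f : 'I_N -> 'cV[R]_N -> R) (alpha : R) : Prop :=
  forall i x z,
    `|partial i (f i) x - partial i (f i) z| <= alpha * enorm (x - z).

Definition concave_own_action {R : realType} {N : nat}
    (f : 'I_N -> 'cV[R]_N -> R) : Prop :=
  forall i x,
    convex_function [set: R^o] (fun a : R^o => - f i (set_action x i a)).

Definition strongly_monotone {R : realType} {N : nat}
    (f : 'I_N -> 'cV[R]_N -> R) (beta : R) : Prop :=
  forall x z,
    dotv (x - z) (pseudograd f x - pseudograd f z) <= - beta * enorm (x - z) ^+ 2.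

(* [t m, s m[ is the m-th communication time, [s m, t m.+1[ the m-th silent
   time. The right-hand side jumps at the switching instants, so the derivative
   of y is taken relative to each half-open interval, and y is required to be
   continuous across them. *)
Definition is_solution {R : realType} {N : nat} (A : 'M[R]_N)
    (f : 'I_N -> 'cV[R]_N -> R) (kbar : 'I_N -> R) (eps : R) (t s : nat -> R)
    (x : R -> 'cV[R]_N) (y : R -> 'cV[R]_(N * N)) : Prop :=
  [/\ {within `[0, +oo[, continuous x},
      {within `[0, +oo[, continuous y},
      forall i (tau : R), 0 <= tau ->
        has_derivative_within `[0, +oo[ (fun u => x u i ord0) tau
          (eps * kbar i * partial i (f i) (est_vec (y tau) i)),
      forall m i j tau, t m <= tau < s m ->
        has_derivative_within `[t m, s m[ (fun u => est (y u) i j) tau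
          (- ((\sum_k A i k * (est (y tau) i j - est (y tau) k j))
              + A i j * (est (y tau) i j - x tau j ord0)))
    & forall m i j tau, s m <= tau < t m.+1 ->
        has_derivative_within `[s m, t m.+1[ (fun u => est (y u) i j) tau 0].

Definition is_equilibrium {R : realType} {N : nat} (A : 'M[R]_N)
    (f : 'I_N -> 'cV[R]_N -> R) (kbar : 'I_N -> R) (eps : R) (t s : nat -> R)
    (xs : 'cV[R]_N) (ys : 'cV[R]_(N * N)) : Prop :=
  is_solution A f kbar eps t s (fun=> xs) (fun=> ys).

Definition exponentially_stable {R : realType} {N : nat} (A : 'M[R]_N)
    (f : 'I_N -> 'cV[R]_N -> R) (kbar : 'I_N -> R) (eps : R) (t s : nat -> R)
    (xs : 'cV[R]_N) (ys : 'cV[R]_(N * N)) : Prop :=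
  exists delta c lambda : R, [/\ 0 < delta, 0 < c, 0 < lambda &
    forall x y, is_solution A f kbar eps t s x y ->
      enorm (col_mx (x 0 - xs) (y 0 - ys)) < delta ->
      forall tau : R, 0 <= tau ->
        enorm (col_mx (x tau - xs) (y tau - ys)) <=
          c * enorm (col_mx (x 0 - xs) (y 0 - ys)) * expR (- lambda * tau)].

(* Here e stands for x - xs. *)
Definition local_lyapunov {R : realType} {N : nat} (f : 'I_N -> 'cV[R]_N -> R)
    (kbar : 'I_N -> R) (xs : 'cV[R]_N) (Vbar : 'cV[R]_N -> R)
    (gamma1 gamma2 gamma3 gamma4 gamma5 : R) : Prop :=
  forall e, enorm e <= gamma5 ->
    [/\ gamma1 * enorm e ^+ 2 <= Vbar e <= gamma2 * enorm e ^+ 2,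
        dotv (grad Vbar e) (diag_mx (\row_i kbar i) *m pseudograd f (xs + e))
          <= - gamma3 * enorm e ^+ 2
      & enorm (grad Vbar e) <= gamma4 * enorm e].

Definition total_lyapunov {R : realType} {N : nat} (P : 'M[R]_(N * N))
    (Vbar : 'cV[R]_N -> R) (e : 'cV[R]_N) (ex : 'cV[R]_(N * N)) : R :=
  Vbar e + dotv ex (P *m ex).

(* The default value 0 is harmless: only used with positive gains. *)
Definition max_gain {R : realType} {N : nat} (kbar : 'I_N -> R) : R :=
  \big[Num.max/0]_i kbar i.

Definition pi1 {R : realType} {N : nat} (alpha gamma4 : R) (kbar : 'I_N -> R)
    (P : 'M[R]_(N * N)) : R :=
  alpha * max_gain kbar * (gamma4 / 2 + N%:R * opnorm P).

Definition pi2 {R : realType} {N : nat} (alpha : R) (kbar : 'I_N -> R)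
    (P : 'M[R]_(N * N)) : R :=
  2 * alpha * Num.sqrt N%:R * opnorm P * max_gain kbar.

Definition eps_star {R : realType} {N : nat} (alpha gamma3 gamma4 : R)
    (kbar : 'I_N -> R) (P Q : 'M[R]_(N * N)) : R :=
  let p1 := pi1 alpha gamma4 kbar P in
  let p2 := pi2 alpha kbar P in
  Num.min (gamma3 * lambda_min Q / (gamma3 * p2 + p1 ^+ 2))
          (gamma3 ^+ 2 * p2 ^+ 2 / p1 ^+ 4).

Definition mx2 {R : realType} (a b c d : R) : 'M[R]_2 :=
  block_mx a%:M b%:M c%:M (d%:M : 'M[R]_1).

Definition Gamma1 {R : realType} {N : nat} (alpha gamma3 gamma4 : R)
    (kbar : 'I_N -> R) (P Q : 'M[R]_(N * N)) (eps : R) : 'M[R]_2 :=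
  let p1 := pi1 alpha gamma4 kbar P in
  let p2 := pi2 alpha kbar P in
  mx2 (eps * gamma3) (- (eps * p1)) (- (eps * p1)) (lambda_min Q - eps * p2).

Definition Gamma2 {R : realType} {N : nat} (alpha gamma3 gamma4 : R)
    (kbar : 'I_N -> R) (P : 'M[R]_(N * N)) (eps : R) : 'M[R]_2 :=
  let p1 := pi1 alpha gamma4 kbar P in
  let p2 := pi2 alpha kbar P in
  mx2 (Num.sqrt eps * gamma3) (eps * p1) (eps * p1) (eps * p2).

(* Main.v *)
(* With e = x - xs and u = y - 1 (x) x, the Lyapunov function V = Vbar(e) + u^T P u
   satisfies, as long as |e| <= gamma5,
     V' <= - (|e|, |u|) Gamma1 (|e|, |u|)^T <= - mu1 V   while communicating,
     V' <= (|e|, |u|) Gamma2 (|e|, |u|)^T <= mu2 V       while silent.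
   The quadratic forms are compared with |e|^2 + |u|^2 through the Rayleigh
   quotient, and the signs mu2 > 0 (Gamma2 has a positive diagonal entry) and hence
   mu1 > 0 come for free. Gronwall's inequality on each subinterval shows that V is
   multiplied by at most expR (- rho T) over a period, with
   rho = mu1 theta - mu2 (1 - theta) > 0, so V decays like expR (- rho t) up to the
   overshoot within one period. Trajectories starting close enough to the
   equilibrium therefore never reach |e| = gamma5: at a first time where they did,
   the decay estimate would still hold and give |e| < gamma5. *)
Require Import Defs.
From HB Require Import structures.
From mathcomp Require Import all_boot all_order all_algebra.
From mathcomp Require Import all_classical all_reals all_analysis.
From mathcomp Require Import mxtens ring lra.

Set Implicit Arguments.
Unset Strict Implicit.
Unset Printing Implicit Defensive.

Import Order.TTheory GRing.Theory Num.Theory.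
Import numFieldNormedType.Exports.

Local Open Scope classical_set_scope.
Local Open Scope ring_scope.

Lemma cvg_sumr {R : realType} (I T : Type) (F : set_system T)
    {FF : Filter F} (r : seq I) (h : I -> T -> R) (l : I -> R) :
  (forall i, h i x @[x --> F] --> l i) ->
  (\sum_(i <- r) h i x) @[x --> F] --> \sum_(i <- r) l i.
Proof. by move=> hl; apply: cvg_big => //; exact: add_continuous. Qed.

(** * Euclidean inner product, norm and operator norm *)

Section euclidean.
Context {R : realType}.

Section fixed_dimension.
Context {n : nat}.
Implicit Types u v w : 'cV[R]_n.

Lemma dotvC u v : dotv u v = dotv v u.
Proof. by apply: eq_bigr => i _; rewrite mulrC. Qed.

Lemma dotvDr u v w : dotv u (v + w) = dotv u v + dotv u w.
Proof. by rewrite -big_split; apply: eq_bigr => i _; rewrite mxE mulrDr. Qed.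

Lemma dotvZr u a v : dotv u (a *: v) = a * dotv u v.
Proof. by rewrite mulr_sumr; apply: eq_bigr => i _; rewrite mxE mulrCA. Qed.

Lemma dotvNr u v : dotv u (- v) = - dotv u v.
Proof. by rewrite -scaleN1r dotvZr mulN1r. Qed.

Lemma dotvDl u v w : dotv (u + v) w = dotv u w + dotv v w.
Proof. by rewrite dotvC dotvDr !(dotvC w). Qed.

Lemma dotvZl u a v : dotv (a *: u) v = a * dotv u v.
Proof. by rewrite dotvC dotvZr dotvC. Qed.

Lemma dotvNl u v : dotv (- u) v = - dotv u v.
Proof. by rewrite dotvC dotvNr dotvC. Qed.

Lemma dotvE u v : dotv u v = (u^T *m v) ord0 ord0.
Proof. by rewrite mxE; apply: eq_bigr => i _; rewrite mxE. Qed.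

Lemma dotv_mulmxr u v (M : 'M[R]_n) : dotv u (M *m v) = dotv (M^T *m u) v.
Proof. by rewrite !dotvE trmx_mul trmxK mulmxA. Qed.

Lemma enorm_ge0 u : 0 <= enorm u.
Proof. exact: sqrtr_ge0. Qed.

Lemma enorm_sqr u : enorm u ^+ 2 = dotv u u.
Proof.
rewrite sqr_sqrtr; last by apply: sumr_ge0 => i _; exact: sqr_ge0.
by apply: eq_bigr => i _; rewrite expr2.
Qed.

Lemma dotvv_ge0 u : 0 <= dotv u u.
Proof. by rewrite -enorm_sqr sqr_ge0. Qed.

Lemma enorm_eq0 u : (enorm u == 0) = (u == 0).
Proof.
apply/idP/eqP => [u0|->]; last first.
  by rewrite /enorm big1 ?sqrtr0// => i _; rewrite mxE expr0n.
have /eqP : dotv u u == 0 by rewrite -enorm_sqr sqrf_eq0.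
move=> /psumr_eq0P u2; apply/colP => i; rewrite mxE.
have /eqP : u i ord0 * u i ord0 = 0 by apply: u2 => // j _; rewrite -expr2 sqr_ge0.
by rewrite mulf_eq0 orbb => /eqP.
Qed.

Lemma dotvv_gt0 u : u != 0 -> 0 < dotv u u.
Proof. by rewrite -enorm_sqr -enorm_eq0 => u0; rewrite exprn_even_gt0. Qed.

Lemma enorm0 : enorm (0 : 'cV[R]_n) = 0.
Proof. by apply/eqP; rewrite enorm_eq0. Qed.

Lemma enormZ a u : enorm (a *: u) = `|a| * enorm u.
Proof.
rewrite -sqrtr_sqr -sqrtrM ?sqr_ge0// mulr_sumr.
by congr Num.sqrt; apply: eq_bigr => i _; rewrite mxE exprMn.
Qed.

Lemma enormN u : enorm (- u) = enorm u.
Proof. by rewrite -scaleN1r enormZ normrN1 mul1r. Qed.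

(** Expand the nonnegative square of [enorm v *: u - enorm u *: v] and cancel the factor
    [enorm u * enorm v]; zero vectors are set aside first so that this factor is positive. *)
Lemma cauchy_schwarz u v : dotv u v <= enorm u * enorm v.
Proof.
have [->|u0] := eqVneq u 0.
  by rewrite enorm0 mul0r /dotv big1// => i _; rewrite mxE mul0r.
have [->|v0] := eqVneq v 0.
  by rewrite enorm0 mulr0 /dotv big1// => i _; rewrite mxE mulr0.
have a0 : 0 < enorm u by rewrite lt_neqAle eq_sym enorm_eq0 u0 enorm_ge0.
have b0 : 0 < enorm v by rewrite lt_neqAle eq_sym enorm_eq0 v0 enorm_ge0.
have := dotvv_ge0 (enorm v *: u - enorm u *: v).
rewrite !(dotvDl, dotvDr, dotvNl, dotvNr, dotvZl, dotvZr) -!enorm_sqr (dotvC v u).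
move=> H; have ab0 := mulr_gt0 a0 b0; rewrite -(ler_pM2l ab0); nra.
Qed.

Lemma ler_norm_dotv u v : `|dotv u v| <= enorm u * enorm v.
Proof.
by rewrite ler_norml cauchy_schwarz andbT lerNl -dotvNl -(enormN u) cauchy_schwarz.
Qed.

Lemma ler_enormD u v : enorm (u + v) <= enorm u + enorm v.
Proof.
rewrite -(ler_pXn2r (ltn0Sn 1)) ?nnegrE ?addr_ge0 ?enorm_ge0// sqrrD.
rewrite !enorm_sqr !(dotvDl, dotvDr) (dotvC v u).
by have := cauchy_schwarz u v; lra.
Qed.

Lemma ler_coord_enorm u i : `|u i ord0| <= enorm u.
Proof.
rewrite -sqrtr_sqr ler_sqrt; last by apply: sumr_ge0 => j _; exact: sqr_ge0.
by rewrite (bigD1 i)//= lerDl sumr_ge0// => j _; exact: sqr_ge0.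
Qed.

Lemma ler_enorm u a : 0 <= a -> enorm u ^+ 2 <= a ^+ 2 -> enorm u <= a.
Proof. by move=> a0; rewrite ler_pXn2r// nnegrE enorm_ge0. Qed.

Lemma ler_enorm_coord u v : (forall i, `|u i ord0| <= v i ord0) -> enorm u <= enorm v.
Proof.
move=> uv; apply: ler_wsqrtr; apply: ler_sum => i _.
by rewrite -[leLHS]real_normK ?num_real// ler_pXn2r// nnegrE (le_trans _ (uv i)).
Qed.

(** The Frobenius norm is a bound, by Cauchy-Schwarz on each row. Boundedness is what makes the
    [sup] in [opnorm] a genuine upper bound. *)
Lemma opnorm_ubound (M : 'M[R]_n) :
  has_ubound [set enorm (M *m v) | v in [set v : 'cV[R]_n | enorm v = 1]].
Proof.
pose F := \sum_i enorm (row i M)^T ^+ 2.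
have F0 : 0 <= F by apply: sumr_ge0 => i _; exact: sqr_ge0.
exists (Num.sqrt F) => _ [v v1 <-]; rewrite ler_sqrt//; apply: ler_sum => i _.
have -> : (M *m v) i ord0 = dotv (row i M)^T v.
  by rewrite mxE; apply: eq_bigr => j _; rewrite !mxE.
rewrite -[leLHS]real_normK ?num_real// ler_pXn2r ?nnegrE ?enorm_ge0//.
by have := ler_norm_dotv (row i M)^T v; rewrite v1 mulr1.
Qed.

Lemma ler_opnorm (M : 'M[R]_n) v : enorm (M *m v) <= opnorm M * enorm v.
Proof.
have [->|v0] := eqVneq v 0; first by rewrite mulmx0 enorm0 mulr0.
have a0 : 0 < enorm v by rewrite lt_neqAle eq_sym enorm_eq0 v0 enorm_ge0.
rewrite -ler_pdivrMr//; apply: ub_le_sup; first exact: opnorm_ubound.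
exists ((enorm v)^-1 *: v).
  by rewrite /= enormZ normfV ger0_norm ?enorm_ge0// mulVf ?gt_eqF.
by rewrite -scalemxAr enormZ normfV ger0_norm ?enorm_ge0// mulrC.
Qed.

(** For the all-ones vector [v], positive definiteness and Cauchy-Schwarz force [M *m v] to be
    nonzero, which a nonpositive [opnorm M] would forbid. *)
Lemma posdef_opnorm_gt0 (M : 'M[R]_n) : (0 < n)%N -> posdef M -> 0 < opnorm M.
Proof.
move=> n0 [_ M0]; pose v : 'cV[R]_n := const_mx 1.
have v0 : v != 0.
  apply/eqP => /colP /(_ (Ordinal n0)); rewrite !mxE => /eqP.
  by rewrite oner_eq0.
have := lt_le_trans (M0 _ v0) (cauchy_schwarz _ _).
have := ler_opnorm M v; have := enorm_ge0 v; have := enorm_ge0 (M *m v).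
by rewrite ltNge => a b c d; rewrite ltNge; apply: contra d => d; nra.
Qed.

Lemma continuous_enorm : continuous (enorm : 'cV[R]_n -> R).
Proof.
move=> v; apply: (@continuous_comp _ _ _ (fun v : 'cV[R]_n => \sum_i v i ord0 ^+ 2)
  Num.sqrt); last exact: sqrt_continuous.
apply: (@cvg_sumr _ _ _ (nbhs v)) => i; rewrite expr2; apply: cvgM; exact: coord_continuous.
Qed.

End fixed_dimension.

Lemma enorm_col_mx_sqr m n (u : 'cV[R]_m) (v : 'cV[R]_n) :
  enorm (col_mx u v) ^+ 2 = enorm u ^+ 2 + enorm v ^+ 2.
Proof.
rewrite !enorm_sqr /dotv big_split_ord /=.
by congr (_ + _); apply: eq_bigr => i _; rewrite ?col_mxEu ?col_mxEd.
Qed.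

(** Row vectors are used because the compactness criterion and [EVT_min_rV] are formulated for
    them. *)
Lemma unit_sphere_compact n : compact [set v : 'rV[R]_n | enorm v^T = 1].
Proof.
apply: bounded_closed_compact.
  exists 1; split; first exact: num_real.
  move=> x x1 v v1 /=; rewrite [leLHS]/Num.Def.normr/= mx_normrE.
  apply/bigmax_leP; split; first by rewrite ltW// (lt_trans _ x1).
  move=> -[i j] _; rewrite ord1 /= (le_trans _ (ltW x1))// -v1.
  by have := ler_coord_enorm v^T j; rewrite mxE.
apply: (@preimage_closed _ _ (fun v : 'rV[R]_n => enorm v^T) [set 1]); last first.
  exact: closed_eq.
move=> v _; rewrite /enorm.
apply: (@continuous_comp _ _ _ (fun v : 'rV[R]_n => \sum_i v^T i ord0 ^+ 2)
  Num.sqrt); last exact: sqrt_continuous.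
rewrite (_ : (fun _ => _) = fun v : 'rV[R]_n => \sum_i v ord0 i ^+ 2); last first.
  by apply/funext => w; apply: eq_bigr => i _; rewrite mxE.
apply: (@cvg_sumr _ _ _ (nbhs v)) => i; rewrite expr2; apply: cvgM; exact: coord_continuous.
Qed.

End euclidean.

(** * Extreme eigenvalues of symmetric matrices and the Rayleigh quotient *)

Section rayleigh.
Context {R : realType}.

(** Near 0 the linear term dominates: at [s = - c / (|b| + 1)] the expression is [c ^+ 2 * (b - (|b|
    + 1)) / (|b| + 1) ^+ 2], negative if [c > 0]. The added 1 keeps the denominator positive. *)
Lemma quadratic_ge0_linear_eq0 (b c : R) :
  0 <= c -> (forall s, 0 <= s * c + s ^+ 2 * b) -> c = 0.
Proof.
move=> c0 /(_ (- c / (`|b| + 1))) H; apply/eqP; rewrite eq_le c0 andbT leNgt.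
apply/negP => cp; have b1 : 0 < `|b| + 1 by rewrite ltr_pwDr.
have : 0 <= (- c / (`|b| + 1) * c + (- c / (`|b| + 1)) ^+ 2 * b) * (`|b| + 1) ^+ 2.
  by rewrite mulr_ge0// sqr_ge0.
rewrite (_ : _ * _ = c ^+ 2 * (b - (`|b| + 1))); last by field; rewrite gt_eqF.
rewrite pmulr_rge0 ?exprn_gt0//; have := ler_norm b; lra.
Qed.

(* The minimum of the quadratic form over the unit sphere is attained, and at a
   minimizer the first-order variation vanishes. *)
Lemma symmetric_min_eigen n (M : 'M[R]_n.+1) : M^T = M ->
  exists a (v : 'cV[R]_n.+1), [/\ v != 0, M *m v = a *: v &
    forall w, a * enorm w ^+ 2 <= dotv w (M *m w)].
Proof.
move=> MT; pose S := [set v : 'rV[R]_n.+1 | enorm v^T = 1].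
pose q (v : 'rV[R]_n.+1) := dotv v^T (M *m v^T).
have normalize (w : 'cV[R]_n.+1) : w != 0 -> enorm ((enorm w)^-1 *: w) = 1.
  by move=> w0; rewrite enormZ normfV ger0_norm ?enorm_ge0// mulVf// enorm_eq0.
have S0 : S !=set0.
  exists (((enorm (const_mx 1 : 'cV[R]_n.+1))^-1 *: const_mx 1)^T).
  rewrite /S /= trmxK normalize//.
  by apply/eqP => /colP /(_ ord0); rewrite !mxE => /eqP; rewrite oner_eq0.
have qc : {within S, continuous q}.
  apply: continuous_subspaceT => v; rewrite /q /dotv.
  apply: (@cvg_sumr _ _ _ (nbhs v)) => i; apply: cvgM.
    rewrite (_ : (fun _ => _) = fun w : 'rV[R]_n.+1 => w ord0 i).
      by rewrite mxE; exact: coord_continuous.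
    by apply/funext => w; rewrite mxE.
  rewrite mxE (_ : (fun _ => _) = fun w : 'rV[R]_n.+1 => \sum_j M i j * w ord0 j).
    apply: (@cvg_sumr _ _ _ (nbhs v)) => j; apply: cvgMr; rewrite mxE.
    exact: coord_continuous.
  by apply/funext => w; rewrite mxE; apply: eq_bigr => j _; rewrite mxE.
have [v vS vmin] := EVT_min_rV S0 (@unit_sphere_compact R _) qc.
move: vS; rewrite inE /S /= => v1.
pose a := q v; pose u := v^T.
have min w : a * enorm w ^+ 2 <= dotv w (M *m w).
  have [->|w0] := eqVneq w 0; first by rewrite enorm0 expr0n mulr0 mulmx0 dotvv_ge0.
  have e0 : 0 < enorm w by rewrite lt_neqAle eq_sym enorm_eq0 w0 enorm_ge0.
  have /vmin : ((enorm w)^-1 *: w)^T \in S by rewrite inE /S /= trmxK normalize.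
  rewrite -/a /q trmxK -scalemxAr dotvZl dotvZr mulrA -expr2 exprVn => H.
  by rewrite -ler_pdivlMr ?exprn_gt0// mulrC.
exists a, u; split => //.
  by rewrite -enorm_eq0 /u v1 oner_eq0.
have auu : dotv u (M *m u) = a by [].
have uu : dotv u u = 1 by rewrite -enorm_sqr v1 expr1n.
(* Moving from [u] along the residual [r] changes the form minus [a] times the squared norm by
   [2 * dotv r r] to first order, so minimality forces the residual to vanish. *)
pose r := M *m u - a *: u.
suff rr : 2 * dotv r r = 0.
  apply/eqP; rewrite -subr_eq0 -enorm_eq0 -sqrf_eq0 enorm_sqr -/r; apply/eqP.
  by lra.
have Mu : M *m u = r + a *: u by rewrite subrK.
clearbody r.
apply: (@quadratic_ge0_linear_eq0 (dotv r (M *m r) - a * dotv r r)).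
  by rewrite mulr_ge0// dotvv_ge0.
move=> s; have := min (u + s *: r).
rewrite enorm_sqr mulmxDr -scalemxAr !(dotvDl, dotvDr, dotvZl, dotvZr) uu auu.
rewrite [dotv u (M *m r)]dotv_mulmxr MT (dotvC (M *m u)) (dotvC u r).
rewrite Mu !(dotvDr, dotvZr); nra.
Qed.

(** [eigenvalue] refers to row eigenvectors; symmetry of [M] lets transposition turn them into
    column eigenvectors. *)
Lemma symmetric_eigenvalueP n (M : 'M[R]_n) a : M^T = M ->
  eigenvalue M a <-> exists2 v : 'cV[R]_n, v != 0 & M *m v = a *: v.
Proof.
move=> MT; split => [/eigenvalueP[v vM v0]|[v v0 Mv]].
  exists v^T; last by rewrite -{1}MT -trmx_mul vM linearZ.
  by apply: contra_neq v0 => /(congr1 trmx); rewrite trmxK trmx0.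
apply/eigenvalueP; exists v^T; last first.
  by apply: contra_neq v0 => /(congr1 trmx); rewrite trmxK trmx0.
by rewrite -{1}MT -trmx_mul Mv linearZ.
Qed.

(** The attained minimum of the form on the sphere is an eigenvalue, and testing the form on any
    other eigenvector shows that it lies below every eigenvalue; hence it is the infimum. *)
Lemma lambda_minP n (M : 'M[R]_n.+1) : M^T = M ->
  eigenvalue M (lambda_min M) /\
  forall w, lambda_min M * enorm w ^+ 2 <= dotv w (M *m w).
Proof.
move=> MT; have [a [v [v0 Mv min]]] := symmetric_min_eigen MT.
have Ma : eigenvalue M a by apply/symmetric_eigenvalueP => //; exists v.
suff -> : lambda_min M = a by [].
have lba : lbound [set b | eigenvalue M b] a.
  move=> b /(symmetric_eigenvalueP _ MT)[w w0 Mw].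
  by have := min w; rewrite Mw dotvZr -enorm_sqr ler_pM2r// enorm_sqr dotvv_gt0.
apply/eqP; rewrite eq_le; apply/andP; split.
  by apply: ge_inf => //; exists a.
by apply: lb_le_inf => //; exists a.
Qed.

Lemma lambda_min_le n (M : 'M[R]_n) w : M^T = M ->
  lambda_min M * enorm w ^+ 2 <= dotv w (M *m w).
Proof.
case: n M w => [|n] M w MT; last exact: (lambda_minP MT).2.
by rewrite enorm_sqr /dotv !big_ord0 mulr0.
Qed.

(** Obtained from the lower bound by negation: the eigenvalues of [- M] are the opposites of those
    of [M]. *)
Lemma lambda_max_ge n (M : 'M[R]_n) w : M^T = M ->
  dotv w (M *m w) <= lambda_max M * enorm w ^+ 2.
Proof.
move=> MT; have NT : (- M)^T = - M by rewrite linearN /= MT.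
have -> : lambda_max M = - lambda_min (- M).
  rewrite /lambda_min /inf opprK /lambda_max; congr sup.
  apply/seteqP; split => [a|_ [a /= aM <-]].
    move=> /(symmetric_eigenvalueP _ MT)[v v0 Mv]; exists (- a); last by rewrite opprK.
    by apply/(symmetric_eigenvalueP _ NT); exists v => //; rewrite mulNmx Mv scaleNr.
  have /(symmetric_eigenvalueP _ NT)[v v0 Mv] := aM.
  apply/(symmetric_eigenvalueP _ MT); exists v => //.
  by rewrite scaleNr -Mv mulNmx opprK.
by have := lambda_min_le w NT; rewrite mulNmx dotvNr; lra.
Qed.

Lemma posdef_lambda_min_gt0 n (M : 'M[R]_n) :
  (0 < n)%N -> posdef M -> 0 < lambda_min M.
Proof.
case: n M => // n M _ [MT M0]; have [lM _] := lambda_minP MT.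
have [v v0 Mv] := (symmetric_eigenvalueP _ MT).1 lM.
by have := M0 v v0; rewrite Mv dotvZr pmulr_lgt0// dotvv_gt0.
Qed.

Section two_by_two.

(** Built by blocks like [mx2], so that block multiplication applies; it will hold the pair of error
    norms on which [Gamma1] and [Gamma2] act. *)
Definition pair_mx (x y : R) : 'cV[R]_2 := col_mx (x%:M : 'M[R]_1) (y%:M : 'M[R]_1).

Lemma enorm_pair_mx x y : enorm (pair_mx x y) ^+ 2 = x ^+ 2 + y ^+ 2.
Proof.
rewrite [LHS](@enorm_col_mx_sqr R 1 1) !enorm_sqr /dotv !big_ord1.
by rewrite !mxE eqxx !mulr1n -!expr2.
Qed.

Lemma mx2_sym (a b d : R) : (mx2 a b b d)^T = mx2 a b b d.
Proof. by apply: etrans (@tr_block_mx _ 1 1 1 1 _ _ _ _) _; rewrite !tr_scalar_mx. Qed.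

Lemma dotv_mx2 a b d x y :
  dotv (pair_mx x y) (mx2 a b b d *m pair_mx x y) =
    a * x ^+ 2 + 2 * b * x * y + d * y ^+ 2.
Proof.
have -> : mx2 a b b d *m pair_mx x y =
    pair_mx (a * x + b * y) (b * x + d * y).
  apply: etrans (@mul_block_col _ 1 1 1 1 1 _ _ _ _ _ _) _.
  by rewrite -!scalar_mxM -!raddfD.
have dotE (u v : 'cV[R]_(1 + 1)) : dotv u v =
    u (lshift 1 ord0) ord0 * v (lshift 1 ord0) ord0 +
    u (rshift 1 ord0) ord0 * v (rshift 1 ord0) ord0.
  by rewrite /dotv big_split_ord !big_ord1.
by rewrite [LHS]dotE /pair_mx !col_mxEu !col_mxEd !mxE eqxx !mulr1n; ring.
Qed.

End two_by_two.

End rayleigh.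

(** * Chain rule for continuously differentiable functions, and Gronwall's inequality *)

Section calculus.
Context {R : realType}.

Section continuously_differentiable.
Context {n : nat}.
Implicit Types (g : 'cV[R]_n -> R) (x z u : 'cV[R]_n).

Lemma is_derive_coordinate_line g z i (s : R) :
  (forall x, derivable g x (delta_mx i ord0)) ->
  is_derive s 1 (fun s : R => g (z + s *: delta_mx i ord0))
    (partial i g (z + s *: delta_mx i ord0)).
Proof.
move=> dg; set w := z + s *: _.
have E : (fun h : R => h^-1 *: (((fun s : R => g (z + s *: delta_mx i ord0))
      \o shift s) (h *: (1 : R)) - g w)) =
    (fun h => h^-1 *: ((g \o shift w) (h *: delta_mx i ord0) - g w)).
  apply/funext => h /=; rewrite /w; congr (_ *: (g _ - _)).
  by rewrite [h *: 1]mulr1 scalerDl addrCA.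
split; first by rewrite /derivable E; exact: dg.
by rewrite /derive E.
Qed.

(** Mean value theorem on a coordinate line, for either sign of [s]. The bound on [c] later keeps
    the intermediate point inside a prescribed ball. *)
Lemma partial_MVT g z i (s : R) :
  (forall x, derivable g x (delta_mx i ord0)) ->
  exists2 c : R, `|c| <= `|s| &
    g (z + s *: delta_mx i ord0) - g z = partial i g (z + c *: delta_mx i ord0) * s.
Proof.
move=> dg; pose G (s : R) := g (z + s *: delta_mx i ord0).
have dG (t : R) : is_derive t 1 G (partial i g (z + t *: delta_mx i ord0)).
  exact: is_derive_coordinate_line.
have cG (A : set R) : {within A, continuous G}.
  apply: continuous_subspaceT => t.
  by apply/differentiable_continuous/derivable1_diffP; case: (dG t).
have G0 : g z = G 0 by rewrite /G scale0r addr0.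
rewrite G0; have [s0|s0] := leP 0 s.
  have [c] := MVT_segment s0 (fun t _ => dG t) (cG _).
  rewrite in_itv /= subr0 => /andP[c0 cs] E; exists c => //.
  by rewrite !ger0_norm.
have [c] := MVT_segment (ltW s0) (fun t _ => dG t) (cG _).
rewrite in_itv /= sub0r mulrN => /andP[cs c0] E; exists c.
  by rewrite ler0_norm// ltr0_norm// lerN2.
by rewrite -[LHS]opprB E opprK.
Qed.

(** The increment is telescoped along the path [p], which replaces the coordinates of [x] by those
    of [u] one at a time. Each piece is a partial derivative at an intermediate point, within [e] of
    its value at [x] by continuity. *)
Lemma C1_first_order g x (e : R) : is_C1 g -> 0 < e ->
  \forall u \near x, `|g u - g x - \sum_i partial i g x * (u i ord0 - x i ord0)|
    <= e * \sum_i `|u i ord0 - x i ord0|.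
Proof.
move=> [dg cg] e0.
have : \forall z \near x, forall i : 'I_n, `|partial i g x - partial i g z| <= e.
  apply: (@filter_forall _ _ _ (nbhs x)) => i.
  by move: (cg i x) => /cvgrPdist_le /(_ e e0).
move=> /nbhs_ballP[r /= r0 xr]; apply/nbhs_ballP; exists r => //= u xu.
pose p k : 'cV[R]_n := \col_i (if (i < k)%N then u i ord0 else x i ord0).
have p0 : p 0%N = x by apply/colP => i; rewrite mxE.
have pn : p n = u by apply/colP => i; rewrite mxE ltn_ord.
have step (k : 'I_n) : p k.+1 = p k + (u k ord0 - x k ord0) *: delta_mx k ord0.
  apply/colP => i; rewrite !mxE eqxx andbT ltnS leq_eqVlt.
  have [->|ik] := eqVneq i k; first by rewrite eqxx ltnn /= mulr1 addrC subrK.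
  by rewrite (negbTE ik : (nat_of_ord i == k) = false) /= mulr0 addr0.
(* The balls are sup-norm balls, so a point whose coordinates are each no further from [x] than
   those of [u] stays in the ball. *)
have xp (k : 'I_n) (c : R) : `|c| <= `|u k ord0 - x k ord0| ->
    ball x r (p k + c *: delta_mx k ord0).
  move=> cux; split => // i j; rewrite ord1 !mxE eqxx andbT.
  have [_ /(_ i ord0)] := xu; rewrite -!ball_normE /= => xui.
  have [->|ik] := eqVneq i k.
    rewrite ltnn mulr1 opprD addNKr normrN (le_lt_trans cux)// distrC.
    by case: xu => _ /(_ k ord0); rewrite -ball_normE.
  by rewrite mulr0 addr0; case: ifP => // _; rewrite subrr normr0.
suff H k : (k <= n)%N ->
    `|g (p k) - g x - \sum_(i < n | (i < k)%N) partial i g x * (u i ord0 - x i ord0)|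
    <= e * \sum_(i < n | (i < k)%N) `|u i ord0 - x i ord0|.
  have := H n (leqnn n); rewrite pn.
  have lt_n : (fun i : 'I_n => (i < n)%N) =1 xpredT by exact: ltn_ord.
  by rewrite !(eq_bigl _ _ lt_n).
elim: k => [_|k IH kn]; first by rewrite p0 subrr !big_pred0// subrr normr0 mulr0.
have {}IH := IH (ltnW kn); pose K := Ordinal kn.
have sumK (F : 'I_n -> R) :
    \sum_(i < n | (i < k.+1)%N) F i = F K + \sum_(i < n | (i < k)%N) F i.
  rewrite (bigD1 K)//=; congr (_ + _); apply: eq_bigl => i.
  by rewrite ltnS ltn_neqAle andbC -(inj_eq val_inj).
rewrite !sumK [in leRHS]mulrDr; have [c cux E] := partial_MVT (p k) (u K ord0 - x K ord0) (dg K).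
rewrite (step K).
have -> : g (p k + (u K ord0 - x K ord0) *: delta_mx K ord0) =
    g (p k) + partial K g (p k + c *: delta_mx K ord0) * (u K ord0 - x K ord0).
  by rewrite -E [RHS]addrC subrK.
set d := u K ord0 - x K ord0; set D := partial K g (_ + _); set S := \sum_(i < n | _) _ * _.
rewrite (_ : g (p k) + D * d - g x - (partial K g x * d + S) =
  (D - partial K g x) * d + (g (p k) - g x - S)); last by ring.
rewrite (le_trans (ler_normD _ _))// lerD// normrM ler_wpM2r// distrC.
exact: (xr _ (xp K c cux) K).
Qed.

Lemma C1_differentiable g x : is_C1 g -> differentiable g x.
Proof.
move=> C1g; pose L (h : 'cV[R]_n) : R := \sum_i partial i g x * h i ord0.
have Llin : linear L.
  move=> a h k; rewrite /L scaler_sumr -big_split; apply: eq_bigr => i _.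
  by rewrite !mxE [a *: _]mulrCA mulrDr.
pose LM := GRing.isLinear.Build _ _ _ _ _ Llin.
pose LL : {linear _ -> _} := HB.pack L LM.
have Lc : continuous LL.
  move=> v; apply: (@cvg_sumr _ _ _ (nbhs v)) => i; apply: cvgMr.
  exact: coord_continuous.
apply/diffP => /=.
(* The differential is defined by choice, so it is enough to exhibit one continuous linear map with
   the required expansion. *)
apply: (@getPex _ (fun df : {linear 'cV[R]_n -> R} => continuous df /\
  forall y, g y = g (lim (nbhs x)) + df (y - lim (nbhs x))
                  +o_(y \near x) (y - lim (nbhs x)))).
exists LL; split=> //; rewrite lim_id//.
suff E : g = (fun y => g x + LL (y - x)) +o_ x (fun y => y - x).
  by move=> y; rewrite {1}E.
apply/eqaddoP => e e0.
(* The sum of the coordinate increments is at most [n] times the sup norm, whence the tolerance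
   [e / (n%:R + 1)]; the added 1 covers [n = 0]. *)
have n1 : 0 < n%:R + 1 :> R by rewrite ltr_pwDr.
have := C1_first_order x C1g (divr_gt0 e0 n1).
apply: filterS => u H.
rewrite -[X in `|X|]/(g u - (g x + LL (u - x))).
have -> : LL (u - x) = \sum_i partial i g x * (u i ord0 - x i ord0).
  by apply: eq_bigr => i _; rewrite !mxE.
rewrite opprD addrA; apply: le_trans H _; rewrite -mulrA ler_pM2l// mulrC ler_pdivrMr//.
have ux i : `|u i ord0 - x i ord0| <= `|u - x|.
  rewrite [leRHS]/Num.Def.normr/= mx_normrE.
  by have := le_bigmax 0 (fun ij : 'I_n * 'I_1 => `|(u - x) ij.1 ij.2|) (i, ord0); rewrite !mxE.
apply: (@le_trans _ _ (\sum_(i < n) `|u - x|)); first exact: ler_sum.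
by rewrite sumr_const card_ord -[leLHS]mulr_natr ler_wpM2l// lerDl.
Qed.

Lemma is_derive_C1_comp g (c : R -> 'cV[R]_n) (t : R) (d : 'cV[R]_n) : is_C1 g ->
  (forall i, is_derive t 1 (fun s => c s i ord0) (d i ord0)) ->
  is_derive t 1 (g \o c) (dotv (grad g (c t)) d).
Proof.
move=> C1g dc; have dg := C1_differentiable (c t) C1g.
have dct : derivable c t 1.
  by apply/derivable_mxP => i j; rewrite ord1; case: (dc i).
have dfc : differentiable c t by apply/derivable1_diffP.
have Dc : 'D_1 c t = d.
  by rewrite derive_mx//; apply/colP => i; rewrite mxE; case: (dc i).
have dgc : differentiable (g \o c) t by exact: differentiable_comp.
split; first exact/derivable1_diffP.
have dct1 : 'd c t 1 = d by rewrite -deriveE.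
rewrite deriveE// diff_comp//= dct1.
rewrite [in LHS](matrix_sum_delta d) linear_sum /dotv; apply: eq_bigr => i _.
by rewrite big_ord1 linearZ /= -deriveE// !mxE mulrC.
Qed.

End continuously_differentiable.

(** The product rule gives two terms, equal by symmetry of [M]; hence the factor 2. *)
Lemma is_derive_dotv_mulmx n (M : 'M[R]_n) (u : R -> 'cV[R]_n) (t : R) (d : 'cV[R]_n) :
  M^T = M -> (forall i, is_derive t 1 (fun s => u s i ord0) (d i ord0)) ->
  is_derive t 1 (fun s => dotv (u s) (M *m u s)) (2 * dotv (u t) (M *m d)).
Proof.
move=> MT du.
have dM i : is_derive t 1 (fun s => (M *m u s) i ord0) ((M *m d) i ord0).
  rewrite (_ : (fun _ => _) = \sum_j (fun s => M i j * u s j ord0)); last first.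
    by apply/funext => s; rewrite mxE fct_sumE.
  by rewrite mxE; apply: is_derive_sum.
rewrite (_ : (fun _ => _) = \sum_i (fun s => u s i ord0 * (M *m u s) i ord0)); last first.
  by apply/funext => s; rewrite fct_sumE.
apply: is_derive_eq.
rewrite big_split /= -[X in _ = X * _]/(1 + 1) mulrDl mul1r; congr (_ + _).
rewrite dotv_mulmxr MT dotvC; apply: eq_bigr => i _ /=.
by rewrite mulrC.
Qed.

(** Near an interior point the restriction to [D] is vacuous; what remains is the change of variable
    from [u] to [h = u - t] in the difference quotient. *)
Lemma has_derivative_within_interior (D : set R) (g : R -> R) (t d : R) :
  nbhs t D -> has_derivative_within D g t d -> is_derive t 1 g d.
Proof.
move=> tD gd.
have H : (fun u => (g u - g t) / (u - t)) @ t^' --> d.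
  move=> A /gd gA.
  have {}gA : \forall u \near t^', D u -> A ((g u - g t) / (u - t)) by exact: gA.
  have tD' : \forall u \near t^', D u by exact: nbhs_dnbhs.
  by apply: filterS2 tD' gA => u Du; exact.
have {}H : (fun h : R => h^-1 *: ((g \o shift t) (h *: (1 : R)) - g t)) @ 0^' --> d.
  move=> A /H; rewrite /fmap /= !near_simpl => -[e e0 eA]; exists e => //= h /= he h0.
  have := eA (h + t); rewrite /ball_ /= addrK [h *: 1]mulr1 mulrC; apply.
    by rewrite opprD addrCA subrr addr0; move: he; rewrite sub0r.
  by apply: contra_neq h0 => /(canRL (addrK t)); rewrite subrr.
by split; [apply/cvg_ex; exists d|exact: cvg_lim].
Qed.

(** [W s * expR (- k * (s - a))] has nonpositive derivative. Differentiability is asked only in the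
    open interval, so the endpoints may be switching instants. *)
Lemma gronwall (W : R -> R) (a b k : R) : {within `[a, b], continuous W} ->
  (forall t, a < t < b -> exists2 d, is_derive t 1 W d & d <= k * W t) ->
  forall t, a <= t <= b -> W t <= W a * expR (k * (t - a)).
Proof.
move=> Wc dW t /andP[at_ tb].
pose G s := W s * expR (- k * (s - a)).
have dexp (s : R) : is_derive s 1 (fun s => expR (- k * (s - a))) (- k * expR (- k * (s - a))).
  apply: is_derive_eq.
  by rewrite subr0 [_ *: 1]mulr1 mulrC.
have dG s : s \in `]a, b[ -> exists2 d, is_derive s 1 G d & d <= 0.
  rewrite in_itv /= => /dW[d Wd dk]; eexists; first exact: (is_deriveM Wd (dexp s)).
  rewrite /= [_ *: _]mulrC [_ *: _]mulrC; have := expR_gt0 (- k * (s - a)); nra.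
have Gc : {within `[a, b], continuous G}.
  apply/subspace_continuousP => s abs; apply: cvgM.
    by move/subspace_continuousP : Wc; exact.
  apply: cvg_within_filter.
  suff : {for s, continuous (fun s => expR (- k * (s - a)))} by [].
  by apply/differentiable_continuous/derivable1_diffP; case: (dexp s).
have := @ler0_derive1_le_cc _ G a b _ _ Gc t a.
rewrite /G subrr mulr0 expR0 mulr1 mulNr expRN => H.
rewrite -ler_pdivrMr ?expR_gt0//; apply: H.
- by move=> s /dG[d []].
- by move=> s /dG[d [_ <-]]; rewrite derive1E.
- by rewrite in_itv /= at_ tb.
- by rewrite in_itv /= lexx (le_trans at_).
- by [].
Qed.

End calculus.

(** * Vectors indexed by pairs of players, and the coupling matrix *)

Section lexicographic_pairs.
Context {R : realType} {N : nat}.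
Implicit Types (x : 'cV[R]_N) (y u : 'cV[R]_(N * N)).

Lemma sum_mxtens_index (F : 'I_(N * N) -> R) :
  \sum_k F k = \sum_i \sum_j F (mxtens_index (i, j)).
Proof.
rewrite pair_bigA /= (reindex (@mxtens_index N N)) /=; last first.
  by exists (@mxtens_unindex N N) => k _; rewrite ?mxtens_indexK ?mxtens_unindexK.
by apply: eq_bigr => -[i j].
Qed.

Lemma est_replicate x i j : est (replicate x) i j = x j ord0.
Proof. by rewrite /est !mxE mxtens_indexK mul1r; congr (x _ _); exact: ord1. Qed.

Lemma estB y u i j : est (y - u) i j = est y i j - est u i j.
Proof. by rewrite /est !mxE. Qed.

Lemma est_vec_sub_replicate y x i : est_vec (y - replicate x) i = est_vec y i - x.
Proof. by apply/colP => j; rewrite !mxE estB est_replicate. Qed.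

Lemma sum_enorm_est_vec u : \sum_i enorm (est_vec u i) ^+ 2 = enorm u ^+ 2.
Proof.
rewrite enorm_sqr /dotv sum_mxtens_index; apply: eq_bigr => i _.
by rewrite enorm_sqr; apply: eq_bigr => j _; rewrite mxE.
Qed.

Lemma enorm_const_mx (a : R) : enorm (const_mx a : 'cV[R]_N) = Num.sqrt N%:R * `|a|.
Proof.
rewrite /enorm (eq_bigr (fun=> a ^+ 2)); last by move=> i _; rewrite mxE.
by rewrite sumr_const card_ord -[in LHS]mulr_natl sqrtrM ?ler0n// sqrtr_sqr.
Qed.

Lemma enorm_replicate x : enorm (replicate x) = Num.sqrt N%:R * enorm x.
Proof.
apply/eqP; rewrite -(@eqrXn2 _ 2)// ?mulr_ge0 ?sqrtr_ge0 ?enorm_ge0//.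
rewrite exprMn [Num.sqrt N%:R ^+ 2]sqr_sqrtr ?ler0n// -sum_enorm_est_vec.
rewrite (eq_bigr (fun=> enorm x ^+ 2)) ?sumr_const ?card_ord ?mulr_natl// => i _.
by congr (enorm _ ^+ 2); apply/colP => j; rewrite mxE est_replicate.
Qed.

(** Translates the Kronecker form into the coordinatewise estimation law: the identity factor keeps
    only the columns [(k, j)], and the Laplacian row becomes a sum of differences. *)
Lemma est_coupling (A : 'M[R]_N) u i j :
  est (coupling A *m u) i j =
    \sum_k A i k * (est u i j - est u k j) + A i j * est u i j.
Proof.
rewrite /est /coupling mulmxDl mxE; congr (_ + _); last first.
  rewrite /diag_weights mul_diag_mx !mxE mxtens_indexK //.
rewrite mxE sum_mxtens_index.
under eq_bigr => k _.
  rewrite (bigD1 j)//= big1 ?addr0; last first.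
    by move=> l lj; rewrite tensmxE [1%:M j l]mxE eq_sym (negbTE lj) mulr0 mul0r.
  rewrite tensmxE [1%:M j j]mxE eqxx mulr1.
  over.
under eq_bigr => k _.
  rewrite (_ : laplacian A i k = (\sum_j A i j) *+ (i == k) - A i k); last by rewrite !mxE.
  rewrite mulrBl.
  over.
rewrite sumrB (bigD1 i)//= eqxx mulr1n [X in _ + X - _]big1 ?addr0; last first.
  by move=> k ki; rewrite eq_sym (negbTE ki) mulr0n mul0r.
by rewrite mulr_suml -sumrB; apply: eq_bigr => k _; rewrite mulrBr.
Qed.

End lexicographic_pairs.

(** * Rates of the two terms of the Lyapunov function *)

Section lyapunov_rates.
Context {R : realType} {N : nat}.
Implicit Types (f : 'I_N -> 'cV[R]_N -> R) (P Q : 'M[R]_(N * N)).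

(** Along player [i]'s own coordinate the payoff is maximal at displacement 0, interior to []-1,
    1[], so its derivative vanishes there. *)
Lemma nash_stationary f xs i : (forall i, is_C2 (f i)) ->
  nash_equilibrium f xs -> partial i (f i) xs = 0.
Proof.
move=> fC2 nash; have [[df _] _] := fC2 i.
have dG t := is_derive_coordinate_line xs t (df i).
have := dG 0; rewrite scale0r addr0 => dG0.
have dmax : is_derive (0 : R) (1 : R) (fun s : R => f i (xs + s *: delta_mx i ord0)) 0.
  apply: (@derive1_at_max _ _ (-1) 1) => [||//|t _]; first by lra.
  - by move=> t _; case: (dG t).
  - by rewrite in_itv /= ltrN10 ltr01.
  rewrite scale0r addr0 (_ : xs + _ = set_action xs i (xs i ord0 + t)); first exact: nash.
  apply/colP => j; rewrite !mxE eqxx andbT.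
  by have [->|] := eqVneq j i; rewrite ?mulr1// mulr0 addr0.
by rewrite -(@derive_val _ _ _ _ _ _ _ dG0) (@derive_val _ _ _ _ _ _ _ dmax).
Qed.

Lemma ler_max_gain (kbar : 'I_N -> R) i : kbar i <= max_gain kbar.
Proof. exact: le_bigmax. Qed.

Lemma max_gain_gt0 (kbar : 'I_N -> R) :
  (0 < N)%N -> (forall i, 0 < kbar i) -> 0 < max_gain kbar.
Proof. by move=> N0 k0; exact: lt_le_trans (k0 (Ordinal N0)) (ler_max_gain _ _). Qed.

Definition action_velocity f (kbar : 'I_N -> R) (eps : R) (y : 'cV[R]_(N * N)) :
  'cV[R]_N := \col_i (eps * kbar i * partial i (f i) (est_vec y i)).

(** Collects the error norm of each player's estimate. It has the same Euclidean norm as [u], so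
    componentwise Lipschitz bounds can be summed without loss. *)
Definition estimate_norms (u : 'cV[R]_(N * N)) : 'cV[R]_N :=
  \col_i enorm (est_vec u i).

Lemma enorm_estimate_norms u : enorm (estimate_norms u) = enorm u.
Proof.
apply/eqP; rewrite -(@eqrXn2 _ 2) ?enorm_ge0// -(sum_enorm_est_vec u) enorm_sqr.
by apply/eqP/eq_bigr => i _; rewrite !mxE expr2.
Qed.

Section estimates.
Context (f : 'I_N -> 'cV[R]_N -> R) (alpha eps : R) (kbar : 'I_N -> R) (xs : 'cV[R]_N).
Context (N0 : (0 < N)%N) (f_lip : lipschitz_partials f alpha) (alpha_gt0 : 0 < alpha)
  (kbar_gt0 : forall i, 0 < kbar i) (eps_gt0 : 0 < eps).

Let mk0 := max_gain_gt0 N0 kbar_gt0.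

(** The partial derivatives vanish at [xs], so (A3) bounds each by [alpha] times the distance from
    the player's estimate to [xs], split through [x]. The second part is the same for all players,
    whence the factor [Num.sqrt N%:R]. *)
Lemma enorm_action_velocity (x : 'cV[R]_N) y :
  (forall i, partial i (f i) xs = 0) ->
  enorm (action_velocity f kbar eps y) <= eps * max_gain kbar * alpha *
    (enorm (y - replicate x) + Num.sqrt N%:R * enorm (x - xs)).
Proof.
move=> stat.
set u := y - replicate x; set c := eps * max_gain kbar * alpha.
have c0 : 0 <= c by rewrite !mulr_ge0// ltW.
apply: (@le_trans _ _ (enorm (c *: (estimate_norms u + const_mx (enorm (x - xs)))))).
  apply: ler_enorm_coord => i; rewrite !mxE normrM ger0_norm; last first.
    by rewrite mulr_ge0// ltW.
  rewrite /c -mulrA; apply: ler_pM => //; first by rewrite mulr_ge0// ltW.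
    by rewrite ler_pM2l// ler_max_gain.
  rewrite -[partial _ _ _]subr0 -(stat i).
  rewrite (le_trans (f_lip _ _ _))// ler_pM2l// /u est_vec_sub_replicate.
  by rewrite (le_trans _ (ler_enormD _ _))// addrA subrK.
rewrite enormZ ger0_norm// ler_wpM2l// (le_trans (ler_enormD _ _))//.
by rewrite enorm_estimate_norms enorm_const_mx ger0_norm ?enorm_ge0.
Qed.

(** Measures, through (A3), the perturbation of the nominal pseudogradient flow caused by using
    estimates in place of true actions. *)
Lemma enorm_velocity_mismatch (x : 'cV[R]_N) y :
  enorm (action_velocity f kbar eps y
      - eps *: (diag_mx (\row_i kbar i) *m pseudograd f x))
    <= eps * max_gain kbar * alpha * enorm (y - replicate x).
Proof.
set u := y - replicate x; set c := eps * max_gain kbar * alpha.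
have c0 : 0 <= c by rewrite !mulr_ge0// ltW.
rewrite -(enorm_estimate_norms u) -[X in X * _]ger0_norm// -enormZ.
apply: ler_enorm_coord => i; rewrite mul_diag_mx !mxE.
rewrite mulrA -mulrBr normrM ger0_norm; last by rewrite mulr_ge0// ltW.
rewrite /c -mulrA; apply: ler_pM => //; first by rewrite mulr_ge0// ltW.
  by rewrite ler_pM2l// ler_max_gain.
by rewrite (le_trans (f_lip _ _ _))// ler_pM2l// /u est_vec_sub_replicate.
Qed.

Context (Vbar : 'cV[R]_N -> R) (gamma1 gamma2 gamma3 gamma4 gamma5 : R).
Context (Vbar_lyapunov :
  local_lyapunov f kbar xs Vbar gamma1 gamma2 gamma3 gamma4 gamma5).

(** The velocity is the nominal flow, along which [Vbar] decreases, plus the mismatch, paired with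
    the gradient by Cauchy-Schwarz. *)
Lemma action_lyapunov_rate (x : 'cV[R]_N) y : enorm (x - xs) <= gamma5 ->
  dotv (grad Vbar (x - xs)) (action_velocity f kbar eps y) <=
    - eps * gamma3 * enorm (x - xs) ^+ 2 +
    eps * max_gain kbar * alpha * gamma4 * enorm (x - xs) * enorm (y - replicate x).
Proof.
move=> e5; have [_ dV gV] := Vbar_lyapunov e5; rewrite (addrC xs) subrK in dV.
set v := action_velocity f kbar eps y.
set w := diag_mx (\row_i kbar i) *m pseudograd f x in dV.
rewrite -[v](subrKC (eps *: w)) dotvDr dotvZr lerD//.
  by rewrite !mulNr -mulrA -mulrN -mulNr ler_pM2l.
rewrite (le_trans (cauchy_schwarz _ _))//.
rewrite [leRHS](_ : _ = (gamma4 * enorm (x - xs)) *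
  (eps * max_gain kbar * alpha * enorm (y - replicate x))); last by ring.
by apply: ler_pM; rewrite ?enorm_ge0// enorm_velocity_mismatch.
Qed.

Context (P : 'M[R]_(N * N)).

(** The effect of the moving actions on the estimation error. One [Num.sqrt N%:R] comes from
    [replicate] and another from the velocity bound; in the cross term they multiply to [N%:R]. *)
Lemma estimate_lyapunov_drift (x : 'cV[R]_N) y :
  (forall i, partial i (f i) xs = 0) -> 0 <= opnorm P -> P^T = P ->
  2 * dotv (y - replicate x) (P *m - replicate (action_velocity f kbar eps y)) <=
    eps * pi2 alpha kbar P * enorm (y - replicate x) ^+ 2 +
    2 * eps * max_gain kbar * alpha * N%:R * opnorm P *
      enorm (x - xs) * enorm (y - replicate x).
Proof.
move=> stat P0 PT; rewrite mulmxN dotvNr -dotvNl.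
set u := y - replicate x; set v := action_velocity _ _ _ _.
have H1 := cauchy_schwarz (- u) (P *m replicate v).
have H2 := ler_opnorm P (replicate v); rewrite enorm_replicate in H2.
have H3 := enorm_action_velocity x y stat; rewrite -/u -/v in H3.
have sN : Num.sqrt N%:R * Num.sqrt N%:R = N%:R :> R by rewrite -expr2 sqr_sqrtr ?ler0n.
have sN0 : 0 <= Num.sqrt N%:R :> R by exact: sqrtr_ge0.
rewrite enormN in H1.
set c := eps * max_gain kbar * alpha in H3.
have {}H3 : enorm u * (opnorm P * (Num.sqrt N%:R * enorm v)) <=
    enorm u * (opnorm P * (Num.sqrt N%:R * (c *
      (enorm u + Num.sqrt N%:R * enorm (x - xs))))).
  by rewrite !ler_wpM2l// enorm_ge0.
have {}H2 := ler_wpM2l (enorm_ge0 u) H2.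
have H := le_trans H1 (le_trans H2 H3).
rewrite [leRHS](_ : _ = 2 * (enorm u * (opnorm P * (Num.sqrt N%:R * (c *
      (enorm u + Num.sqrt N%:R * enorm (x - xs))))))); first by rewrite ler_pM2l.
move: sN; rewrite /pi2 /c; set r := Num.sqrt _ => <-; ring.
Qed.

Context (A : 'M[R]_N) (Q : 'M[R]_(N * N)).

(** Both summands of the Lyapunov equation contribute the same number to [dotv u (Q *m u)], so the
    left side is its opposite. *)
Lemma estimate_lyapunov_dissipation u : P^T = P -> Q^T = Q ->
  (coupling A)^T *m P + P *m coupling A = Q ->
  2 * dotv u (P *m - (coupling A *m u)) <= - lambda_min Q * enorm u ^+ 2.
Proof.
move=> PT QT PQ; have := lambda_min_le u QT; rewrite -PQ mulmxDl dotvDr.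
rewrite [X in _ <= X + _ -> _](_ : _ = dotv u (P *m (coupling A *m u))).
  by rewrite -mulmxA mulmxN dotvNr mulmxA; lra.
by rewrite dotv_mulmxr trmx_mul PT trmxK dotvC -mulmxA.
Qed.

End estimates.

End lyapunov_rates.

(** * Scalar comparison over the periods, and a barrier argument *)

Section scalar_comparison.
Context {R : realType}.

Section periodic.
Context (W : R -> R) (T theta mu1 mu2 S : R).
Context (T_gt0 : 0 < T) (theta01 : 0 < theta < 1)
  (mu1_ge0 : 0 <= mu1) (mu2_ge0 : 0 <= mu2).
Let rho := mu1 * theta - mu2 * (1 - theta).
Context (rho_ge0 : 0 <= rho).
Context (W_ge0 : forall t, 0 <= t <= S -> 0 <= W t)
  (W_cont : {within `[0, S], continuous W}).
Context (W_comm : forall (m : nat) (t : R), m%:R * T < t < (m%:R + theta) * T -> t < S ->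
    exists2 d, is_derive t (1 : R) W d & d <= - mu1 * W t)
  (W_silent : forall (m : nat) (t : R), (m%:R + theta) * T < t < m.+1%:R * T -> t < S ->
    exists2 d, is_derive t (1 : R) W d & d <= mu2 * W t).

Let period_ge0 (m : nat) : 0 <= m%:R * T.
Proof. by rewrite mulr_ge0// ltW. Qed.

Let switch_le (m : nat) : m%:R * T <= (m%:R + theta) * T <= m.+1%:R * T.
Proof.
by case/andP: theta01 => *; rewrite !ler_pM2r// lerDl -natr1 lerD2l !ltW.
Qed.

Let within_sub a t : 0 <= a -> t <= S -> {within `[a, t], continuous W}.
Proof.
move=> a0 tS; apply: continuous_subspaceW W_cont.
by apply: subset_itv; rewrite bnd_simp.
Qed.

Let comm_bound (m : nat) t : m%:R * T <= t <= (m%:R + theta) * T -> t <= S ->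
  W t <= W (m%:R * T) * expR (- mu1 * (t - m%:R * T)).
Proof.
move=> /andP[mt ts] tS; apply: (@gronwall _ W _ t).
- exact: within_sub.
- move=> r /andP[mr rt]; apply: (@W_comm m); last exact: lt_le_trans tS.
  by rewrite mr (lt_le_trans rt).
- by rewrite mt lexx.
Qed.

Let silent_bound (m : nat) t : (m%:R + theta) * T <= t <= m.+1%:R * T -> t <= S ->
  W t <= W ((m%:R + theta) * T) * expR (mu2 * (t - (m%:R + theta) * T)).
Proof.
have /andP[ms _] := switch_le m.
move=> /andP[st tm] tS; apply: (@gronwall _ W _ t).
- exact: within_sub (le_trans (period_ge0 m) ms) _.
- move=> r /andP[sr rt]; apply: (@W_silent m); last exact: lt_le_trans tS.
  by rewrite sr (lt_le_trans rt).
- by rewrite st lexx.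
Qed.

(** Communication lasts [theta * T] and silence [(1 - theta) * T]; the two Gronwall exponents add up
    to [- rho * T]. *)
Let decay_over_period (m : nat) : m.+1%:R * T <= S ->
  W (m.+1%:R * T) <= W (m%:R * T) * expR (- rho * T).
Proof.
move=> mS; have /andP[ms sm] := switch_le m.
have H1 := comm_bound (t := (m%:R + theta) * T) (m := m).
have H2 := silent_bound (t := m.+1%:R * T) (m := m).
apply: le_trans (H2 _ mS) _; first by rewrite sm lexx.
rewrite (_ : - rho * T = - mu1 * ((m%:R + theta) * T - m%:R * T) +
  mu2 * (m.+1%:R * T - (m%:R + theta) * T)).
  rewrite expRD mulrA ler_wpM2r ?expR_ge0// H1 ?ms ?lexx//.
  exact: le_trans mS.
by rewrite -natr1 /rho; ring.
Qed.

(** While communicating [W] stays below its value at the start of the period; the silent phase then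
    lasts at most [(1 - theta) * T]. *)
Let growth_within_period (m : nat) t : m%:R * T <= t <= m.+1%:R * T -> t <= S ->
  W t <= W (m%:R * T) * expR (mu2 * (1 - theta) * T).
Proof.
case/andP: theta01 => th0 th1.
move=> /andP[mt tm] tS; have /andP[ms sm] := switch_le m.
have Wm : 0 <= W (m%:R * T) by rewrite W_ge0// period_ge0 (le_trans mt).
have decr r : m%:R * T <= r <= (m%:R + theta) * T -> r <= S -> W r <= W (m%:R * T).
  move=> mr rS; apply: le_trans (comm_bound mr rS) _.
  rewrite ler_piMr// expR_le1 mulNr oppr_le0 mulr_ge0// subr_ge0.
  by case/andP: mr.
have [ts|st] := leP t ((m%:R + theta) * T).
  apply: (@le_trans _ _ (W (m%:R * T))); first by apply: decr => //; rewrite mt.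
  rewrite ler_peMr// -[leLHS]expR0 ler_expR; apply: mulr_ge0 (ltW T_gt0).
  by apply: mulr_ge0 => //; rewrite subr_ge0 ltW.
apply: le_trans (silent_bound (m := m) _ tS) _; first by rewrite (ltW st).
apply: ler_pM; rewrite ?expR_ge0//.
- by apply: W_ge0; rewrite (le_trans (period_ge0 m) ms) (le_trans (ltW st)).
- by apply: decr; [rewrite ms lexx|exact: le_trans (ltW st) tS].
rewrite ler_expR -mulrA ler_wpM2l// (le_trans (lerB tm (lexx _)))//.
by rewrite -mulrBl -natr1 opprD addrACA subrr add0r.
Qed.

Let decay_at_period (m : nat) : m%:R * T <= S -> W (m%:R * T) <= W 0 * expR (- rho * (m%:R * T)).
Proof.
elim: m => [|m IH] mS; first by rewrite !mul0r mulr0 expR0 mulr1.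
have mS' : m%:R * T <= S.
  by apply: le_trans mS; rewrite ler_pM2r// ler_nat.
apply: le_trans (decay_over_period mS) _.
rewrite (_ : - rho * (m.+1%:R * T) = - rho * (m%:R * T) + - rho * T); last first.
  by rewrite -natr1; ring.
by rewrite expRD mulrA ler_wpM2r ?expR_ge0// IH.
Qed.

Lemma periodic_decay t : 0 <= t <= S ->
  W t <= W 0 * expR (mu2 * (1 - theta) * T + rho * T) * expR (- rho * t).
Proof.
move=> /andP[t0 tS]; pose m := Num.truncn (t / T).
have /andP[] : m%:R <= t / T < m.+1%:R by rewrite truncn_itv// divr_ge0// ltW.
rewrite ler_pdivlMr// ltr_pdivrMr// => mt tm.
apply: le_trans (growth_within_period (m := m) _ tS) _; first by rewrite mt ltW.
have W0 : 0 <= W 0 by rewrite W_ge0// lexx (le_trans t0).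
apply: (@le_trans _ _ (W 0 * expR (- rho * (m%:R * T)) * expR (mu2 * (1 - theta) * T))).
  by rewrite ler_wpM2r ?expR_ge0// decay_at_period// (le_trans mt).
rewrite -!mulrA ler_wpM2l// -!expRD ler_expR.
(* With [m] completed periods, the decay is known at [m%:R * T] rather than at [t]. The extra
   [rho * T] in the prefactor pays for this, since [t] is less than one period later. *)
rewrite -subr_ge0 [leRHS](_ : _ = rho * (m.+1%:R * T - t)); last by rewrite -natr1; ring.
by rewrite mulr_ge0// subr_ge0 ltW.
Qed.

End periodic.

(** At a first time where [g] reaches [c], the bound [g <= c] holds up to that time, and the
    hypothesis yields the contradiction [g < c] there. *)
Lemma continuous_barrier (g : R -> R) (c : R) : {within `[0, +oo[, continuous g} ->
  g 0 < c ->
  (forall s, 0 <= s -> (forall t, 0 <= t <= s -> g t <= c) -> g s < c) ->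
  forall t, 0 <= t -> g t < c.
Proof.
move=> gc g0 step t1 t1_ge0; rewrite ltNge; apply/negP => gt1.
have gsub (b : R) : {within `[0, b], continuous g}.
  by apply: continuous_subspaceW gc; apply: subset_itv.
pose C := [set s | 0 <= s /\ g s = c].
have hit (s : R) : 0 <= s -> c <= g s -> exists2 r, C r & r <= s.
  move=> s0 cs; have [|r] := @IVT _ g 0 s c s0 (gsub s).
    by rewrite ge_min (ltW g0) le_max cs orbT.
  by rewrite in_itv /= => /andP[r0 rs] gr; exists r.
have [r0 Cr0 _] := hit t1 t1_ge0 gt1.
have Cinf : has_inf C by split; [exists r0|exists 0 => r []].
pose S := inf C.
have S0 : 0 <= S by apply: lb_le_inf; [exists r0|move=> r []].
(* The infimum of the hitting times is itself one: otherwise continuity would give a neighbourhood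
   free of them. *)
have gS : g S = c.
  apply/eqP; apply: contrapT => /negP gSc.
  have : \forall r \near within `[0, +oo[%classic (nbhs S), g r != c.
    have : g @ within `[0, +oo[%classic (nbhs S) --> g S.
      by move/subspace_continuousP : gc; apply; rewrite /= in_itv /= S0.
    move/(_ [set z | z != c]); apply.
    by apply: open_nbhs_nbhs; split; [exact: open_neq|].
  move=> /nbhs_ballP[e /= e0 eg].
  have [r [r_ge0 gr] re] := inf_adherent e0 Cinf.
  have Sr : S <= r by apply: ge_inf => //; case: Cinf.
  have : g r != c.
    apply: eg; last by rewrite /= in_itv /= r_ge0.
    by rewrite -ball_normE /= distrC ger0_norm ?subr_ge0// ltrBlDl.
  by rewrite gr eqxx.
suff : g S < c by rewrite gS ltxx.
(* A value above [c] at some [t <= S] would produce a hitting time at most [t]; so [t = S], where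
   [g] equals [c]. *)
apply: step => // t /andP[t0 tS]; rewrite leNgt; apply/negP => ct.
have [r Cr rt] := hit t t0 (ltW ct).
have Sr : S <= r by apply: ge_inf => //; case: Cinf.
have tE : t = S by apply/eqP; rewrite eq_le tS (le_trans Sr).
by move: ct; rewrite tE gS ltxx.
Qed.

End scalar_comparison.

(** * The Lyapunov function along trajectories, and the change of error coordinates *)

Section closed_loop.
Context {R : realType} {N : nat}.

Lemma is_derive_total_lyapunov (P : 'M[R]_(N * N)) (Vbar : 'cV[R]_N -> R)
    (xs : 'cV[R]_N) (x : R -> 'cV[R]_N) (y : R -> 'cV[R]_(N * N)) (t : R)
    (v : 'cV[R]_N) (w : 'cV[R]_(N * N)) :
  is_C1 Vbar -> P^T = P ->
  (forall i, is_derive t (1 : R) (fun s => x s i ord0) (v i ord0)) ->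
  (forall i j, is_derive t (1 : R) (fun s => est (y s) i j) (est w i j)) ->
  is_derive t (1 : R)
    (fun s => total_lyapunov P Vbar (x s - xs) (y s - replicate (x s)))
    (dotv (grad Vbar (x t - xs)) v +
     2 * dotv (y t - replicate (x t)) (P *m (w - replicate v))).
Proof.
move=> VC1 PT dx dy; apply: is_deriveD.
  apply: (@is_derive_C1_comp _ _ Vbar (fun s => x s - xs)) => // i.
  rewrite (_ : (fun _ => _) = (fun s => x s i ord0) - cst (xs i ord0)); last first.
    by apply/funext => s; rewrite !mxE.
  by apply: is_derive_eq; rewrite subr0.
apply: (@is_derive_dotv_mulmx _ _ P (fun s => y s - replicate (x s))) => // k.
case: (mxtens_indexP k) => i j.
rewrite (_ : (fun _ => _) = (fun s => est (y s) i j) - (fun s => x s j ord0)); last first.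
  by apply/funext => s; rewrite -[LHS]/(est _ i j) estB est_replicate.
rewrite -[X in is_derive _ _ _ X]/(est (w - replicate v) i j) estB est_replicate.
exact: is_deriveB.
Qed.

(** The filter is arbitrary so as to include neighbourhoods within [[0, +oo[], which are one-sided
    at time 0. *)
Lemma cvg_total_lyapunov (P : 'M[R]_(N * N)) (Vbar : 'cV[R]_N -> R)
    (xs : 'cV[R]_N) (x : R -> 'cV[R]_N) (y : R -> 'cV[R]_(N * N)) (t : R)
    (F : set_system R) {FF : Filter F} :
  is_C1 Vbar -> x @ F --> x t -> y @ F --> y t ->
  total_lyapunov P Vbar (x s - xs) (y s - replicate (x s)) @[s --> F] -->
    total_lyapunov P Vbar (x t - xs) (y t - replicate (x t)).
Proof.
move=> VC1 xF yF; apply: cvgD.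
  apply: (@cvg_comp _ _ _ (fun s => x s - xs) Vbar _ (nbhs (x t - xs))).
    by apply: cvgB => //; exact: cvg_cst.
  exact: differentiable_continuous (C1_differentiable (x t - xs) VC1).
have uF k : (y s - replicate (x s)) k ord0 @[s --> F] -->
    (y t - replicate (x t)) k ord0.
  case: (mxtens_indexP k) => i j.
  rewrite -[X in _ --> X]/(est _ i j) estB est_replicate.
  rewrite (_ : (fun _ => _) = fun s => est (y s) i j - x s j ord0); last first.
    by apply/funext => s; rewrite -[LHS]/(est _ i j) estB est_replicate.
  apply: cvgB.
    by apply: (@cvg_comp _ _ _ y (fun z => est z i j) _ (nbhs (y t))) => //;
      exact: coord_continuous.
  by apply: (@cvg_comp _ _ _ x (fun z => z j ord0) _ (nbhs (x t))) => //;
    exact: coord_continuous.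
apply: cvg_sumr => k; apply: cvgM; first exact: uF.
rewrite mxE (_ : (fun _ => _) =
    fun s => \sum_l P k l * (y s - replicate (x s)) l ord0); last first.
  by apply/funext => s; rewrite mxE.
by apply: cvg_sumr => l; apply: cvgMr; exact: uF.
Qed.

(** The errors relative to [replicate x] and [replicate xs] differ by a vector of norm
    [Num.sqrt N%:R * enorm (x - xs)]; the inequality [(q + r) ^+ 2 <= 2 * q ^+ 2 + 2 * r ^+ 2] gives
    the constant. *)
Lemma sqr_norm_change (x xs : 'cV[R]_N) (y : 'cV[R]_(N * N)) :
  enorm (x - xs) ^+ 2 + enorm (y - replicate x) ^+ 2 <=
    (2 * N%:R + 2) * enorm (col_mx (x - xs) (y - replicate xs)) ^+ 2 /\
  enorm (col_mx (x - xs) (y - replicate xs)) ^+ 2 <=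
    (2 * N%:R + 2) * (enorm (x - xs) ^+ 2 + enorm (y - replicate x) ^+ 2).
Proof.
rewrite enorm_col_mx_sqr.
have repB : replicate x - replicate xs = replicate (x - xs).
  apply/colP => k; case: (mxtens_indexP k) => i j.
  by rewrite -[LHS]/(est _ i j) -[RHS]/(est _ i j) estB !est_replicate !mxE.
have sN : (Num.sqrt N%:R * enorm (x - xs)) ^+ 2 = N%:R * enorm (x - xs) ^+ 2.
  by rewrite exprMn [Num.sqrt _ ^+ 2]sqr_sqrtr ?ler0n.
have H1 := ler_enormD (y - replicate xs) (- replicate (x - xs)).
have H2 := ler_enormD (y - replicate x) (replicate (x - xs)).
rewrite enormN enorm_replicate -repB opprB addrA subrK in H1.
rewrite enorm_replicate -repB addrA subrK in H2.
have := enorm_ge0 (x - xs); have := enorm_ge0 (y - replicate xs).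
have := enorm_ge0 (y - replicate x); have := sqrtr_ge0 (N%:R : R).
have := ler0n R N; move: H1 H2 sN.
set a := enorm (x - xs); set b := enorm (y - replicate xs).
set c := enorm (y - replicate x); set r := Num.sqrt _ * a => H1 H2 rE N0 _ c0 b0 a0.
have r0 : 0 <= r by rewrite mulr_ge0// sqrtr_ge0.
have sq p q : 0 <= p -> p <= q + r -> 0 <= q -> p ^+ 2 <= 2 * q ^+ 2 + 2 * (N%:R * a ^+ 2).
  by move=> p0 pq q0; rewrite -rE; have := sqr_ge0 (q - r); nra.
have S1 := sq _ _ c0 H1 b0; have S2 := sq _ _ b0 H2 c0.
have := sqr_ge0 a; have := sqr_ge0 b; have := sqr_ge0 c; nra.
Qed.

End closed_loop.

(** * Decay rates of the closed loop and local exponential stability *)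

Section intermittent_communication.
Context {R : realType} {N : nat} (A : 'M[R]_N) (P Q : 'M[R]_(N * N))
  (f : 'I_N -> 'cV[R]_N -> R) (alpha : R) (kbar : 'I_N -> R) (xs : 'cV[R]_N)
  (Vbar : 'cV[R]_N -> R) (gamma1 gamma2 gamma3 gamma4 gamma5 eta1 eta2 eps : R).
Context (N_gt0 : (0 < N)%N) (P_pos : posdef P) (Q_pos : posdef Q)
  (PQ_lyapunov : (coupling A)^T *m P + P *m coupling A = Q)
  (alpha_gt0 : 0 < alpha) (f_lip : lipschitz_partials f alpha)
  (xs_stationary : forall i, partial i (f i) xs = 0)
  (kbar_gt0 : forall i, 0 < kbar i) (Vbar_C1 : is_C1 Vbar)
  (gamma3_gt0 : 0 < gamma3) (gamma5_gt0 : 0 < gamma5)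
  (Vbar_lyapunov :
    local_lyapunov f kbar xs Vbar gamma1 gamma2 gamma3 gamma4 gamma5)
  (eta1_gt0 : 0 < eta1) (eta2_gt0 : 0 < eta2)
  (V_bounds : forall e ex, enorm e <= gamma5 ->
    eta1 * (enorm e ^+ 2 + enorm ex ^+ 2) <= total_lyapunov P Vbar e ex
      <= eta2 * (enorm e ^+ 2 + enorm ex ^+ 2))
  (eps_gt0 : 0 < eps).

Let mu1 := lambda_min (Gamma1 alpha gamma3 gamma4 kbar P Q eps) / eta2.
Let mu2 := lambda_max (Gamma2 alpha gamma3 gamma4 kbar P eps) / eta1.
Let V (x : 'cV[R]_N) (y : 'cV[R]_(N * N)) := total_lyapunov P Vbar (x - xs) (y - replicate x).
Let NN_gt0 : (0 < N * N)%N. Proof. by rewrite muln_gt0 N_gt0. Qed.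
Let opP_ge0 : 0 <= opnorm P. Proof. exact: ltW (posdef_opnorm_gt0 NN_gt0 P_pos). Qed.

(** The Rayleigh bound at the first basis vector involves only the entry [Num.sqrt eps * gamma3]. *)
Lemma lambda_max_Gamma2_gt0 : 0 < lambda_max (Gamma2 alpha gamma3 gamma4 kbar P eps).
Proof.
have := lambda_max_ge (pair_mx 1 0) (mx2_sym (Num.sqrt eps * gamma3)
  (eps * pi1 alpha gamma4 kbar P) (eps * pi2 alpha kbar P)).
rewrite dotv_mx2 enorm_pair_mx expr0n /= expr1n !mulr0 !addr0 !mulr1.
by apply: lt_le_trans; rewrite mulr_gt0// sqrtr_gt0.
Qed.

(** The cross terms of the action and drift estimates add up to [2 * eps * pi1], and [lambda_min Q]
    comes from the dissipation: together they form the quadratic form of [Gamma1]. The sign of [mu1]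
    allows multiplying the upper bound on [V] by it. *)
Lemma communication_rate (x : 'cV[R]_N) y : 0 <= mu1 -> enorm (x - xs) <= gamma5 ->
  dotv (grad Vbar (x - xs)) (action_velocity f kbar eps y) +
    2 * dotv (y - replicate x) (P *m (- (coupling A *m (y - replicate x)) -
      replicate (action_velocity f kbar eps y))) <= - mu1 * V x y.
Proof.
move=> mu10 e5; have [PT _] := P_pos; have [QT _] := Q_pos.
have H1 := action_lyapunov_rate N_gt0 f_lip alpha_gt0 kbar_gt0 eps_gt0 Vbar_lyapunov y e5.
have H2 := estimate_lyapunov_drift N_gt0 f_lip alpha_gt0 kbar_gt0 eps_gt0 x y
  xs_stationary opP_ge0 PT.
have H3 := estimate_lyapunov_dissipation (y - replicate x) PT QT PQ_lyapunov.
rewrite mulmxDr dotvDr mulrDr.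
have := lambda_min_le (pair_mx (enorm (x - xs)) (enorm (y - replicate x)))
  (mx2_sym (eps * gamma3) (- (eps * pi1 alpha gamma4 kbar P))
     (lambda_min Q - eps * pi2 alpha kbar P)).
rewrite dotv_mx2 enorm_pair_mx -[X in lambda_min X]/(Gamma1 _ _ _ _ _ _ _) => H4.
have /andP[_ H5] := V_bounds (y - replicate x) e5.
have H6 := ler_wpM2l mu10 H5; rewrite mulrA {2}/mu1 divfK ?gt_eqF// in H6.
rewrite /V.
move: H1 H2 H3 H4 H6; rewrite {1}/pi1.
set a := enorm _; set b := enorm _; lra.
Qed.

(** With frozen estimates the dissipation disappears and only the drift remains. As [mu2] is
    nonnegative, the lower bound on [V] turns the Rayleigh bound into a rate. *)
Lemma silent_rate (x : 'cV[R]_N) y : enorm (x - xs) <= gamma5 ->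
  dotv (grad Vbar (x - xs)) (action_velocity f kbar eps y) +
    2 * dotv (y - replicate x)
      (P *m (0 - replicate (action_velocity f kbar eps y))) <= mu2 * V x y.
Proof.
move=> e5; have [PT _] := P_pos.
have H1 := action_lyapunov_rate N_gt0 f_lip alpha_gt0 kbar_gt0 eps_gt0 Vbar_lyapunov y e5.
have H2 := estimate_lyapunov_drift N_gt0 f_lip alpha_gt0 kbar_gt0 eps_gt0 x y
  xs_stationary opP_ge0 PT.
rewrite sub0r.
have := lambda_max_ge (pair_mx (enorm (x - xs)) (enorm (y - replicate x)))
  (mx2_sym (Num.sqrt eps * gamma3) (eps * pi1 alpha gamma4 kbar P)
     (eps * pi2 alpha kbar P)).
rewrite dotv_mx2 enorm_pair_mx -[X in _ <= lambda_max X * _ -> _]/(Gamma2 _ _ _ _ _ _) => H4.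
have /andP[H5 _] := V_bounds (y - replicate x) e5.
have mu20 : 0 <= mu2 by rewrite divr_ge0// ltW// lambda_max_Gamma2_gt0.
have H6 := ler_wpM2l mu20 H5; rewrite mulrA {1}/mu2 divfK ?gt_eqF// in H6.
rewrite /V.
(* The estimates give the rate - eps * gamma3 for |e|^2, so the positive entry
   sqrt eps * gamma3 of Gamma2 leaves slack. *)
have H7 : 0 <= Num.sqrt eps * gamma3 * enorm (x - xs) ^+ 2.
  by rewrite mulr_ge0 ?sqr_ge0// mulr_ge0 ?sqrtr_ge0// ltW.
have H8 : 0 <= eps * gamma3 * enorm (x - xs) ^+ 2.
  by rewrite mulr_ge0 ?sqr_ge0// mulr_ge0// ltW.
move: H1 H2 H4 H6 H7 H8; rewrite {1}/pi1.
set a := enorm _; set b := enorm _; lra.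
Qed.

Context (T theta : R) (T_gt0 : 0 < T) (theta01 : 0 < theta < 1).
Let rho := mu1 * theta - mu2 * (1 - theta).
Context (rho_gt0 : 0 < rho).
Let t m : R := m%:R * T.
Let s m : R := (m%:R + theta) * T.

Let mu2_ge0 : 0 <= mu2.
Proof. by rewrite divr_ge0// ltW// lambda_max_Gamma2_gt0. Qed.

Let mu1_ge0 : 0 <= mu1.
Proof.
case/andP: theta01 => th0 th1; rewrite leNgt; apply/negP => mu10.
by have := mulr_ge0 mu2_ge0 (ltW (eqbRL (subr_gt0 _ _) th1)); move: rho_gt0; rewrite /rho; nra.
Qed.

Let K : R := 2 * N%:R + 2.
Let growth : R := expR (mu2 * (1 - theta) * T + rho * T).
(** The root undoes the squares of the Lyapunov bounds; [K ^+ 2] pays for changing error coordinates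
    at both ends, [eta2 / eta1] for comparing [V] with norms, and [growth] is the prefactor of
    [periodic_decay]. *)
Let overshoot : R := Num.sqrt (K ^+ 2 * eta2 / eta1 * growth).
Let z (x : R -> 'cV[R]_N) (y : R -> 'cV[R]_(N * N)) (tau : R) : R :=
  enorm (col_mx (x tau - xs) (y tau - replicate xs)).

Let K_gt0 : 0 < K.
Proof. by rewrite /K ltr_wpDl// mulr_ge0// ler0n. Qed.

Lemma overshoot_gt0 : 0 < overshoot.
Proof. by rewrite sqrtr_gt0 !mulr_gt0 ?invr_gt0 ?exprn_gt0 ?expR_gt0. Qed.

(** As long as the action error stays within [gamma5], both rate inequalities hold and [V] decays at
    rate [rho]; the norm, of the order of the root of [V], decays at half that rate. *)
Lemma decay_while_close (x : R -> 'cV[R]_N) y (S : R) :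
  is_solution A f kbar eps t s x y ->
  (forall r : R, 0 <= r <= S -> enorm (x r - xs) <= gamma5) ->
  forall tau : R, 0 <= tau <= S ->
    z x y tau <= overshoot * z x y 0 * expR (- (rho / 2) * tau).
Proof.
move=> [cx cy dx dcomm dsil] close tau tauS; have [PT _] := P_pos.
pose W r := V (x r) (y r).
have Wc : {within `[0, S], continuous W}.
  suff : {within `[0, +oo[, continuous W}.
    by apply: continuous_subspaceW; apply: subset_itv.
  apply/subspace_continuousP => r r0; apply: cvg_total_lyapunov => //.
    by move/subspace_continuousP : cx; exact.
  by move/subspace_continuousP : cy; exact.
have dxi (r : R) i : 0 < r -> is_derive r (1 : R) (fun u => x u i ord0)
    (action_velocity f kbar eps (y r) i ord0).
  move=> r0; rewrite mxE; apply: (@has_derivative_within_interior _ `[0, +oo[).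
    apply: (filterS _ (lt_nbhsr r0)) => u u0.
    by rewrite /= in_itv /= (ltW u0).
  exact: dx (ltW r0).
have nbhs_co (a b r : R) : a < r < b -> nbhs r `[a, b[%classic.
  move=> /andP[ar rb].
  have : \forall u \near nbhs r, u \in `]a, b[%R by apply: near_in_itvoo; rewrite in_itv /= ar.
  by apply: filterS => u; rewrite /= !in_itv /= => /andP[/ltW -> ->].
have t_ge0 m : 0 <= t m by rewrite mulr_ge0// ltW.
have s_ge0 m : 0 <= s m.
  by case/andP: theta01 => th0 _; rewrite mulr_ge0 ?addr_ge0// ltW.
have W_ge0 (r : R) : 0 <= r <= S -> 0 <= W r.
  move=> rS; have /andP[H _] := V_bounds (y r - replicate (x r)) (close r rS).
  by apply: le_trans H; rewrite mulr_ge0 ?(ltW eta1_gt0)// addr_ge0// sqr_ge0.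
have := @periodic_decay R W T theta mu1 mu2 S T_gt0 theta01 mu1_ge0 mu2_ge0
  (ltW rho_gt0) W_ge0 Wc _ _ tau tauS.
rewrite -/rho -/growth => H.
have {}H : W tau <= W 0 * growth * expR (- rho * tau).
  apply: H.
    move=> m r /andP[tr rs] rS; have r0 := le_lt_trans (t_ge0 m) tr.
    eexists; last first.
      by apply: communication_rate => //; apply: close; rewrite !ltW.
    apply: is_derive_total_lyapunov => //; first by move=> i; exact: dxi.
    move=> i j; apply: (@has_derivative_within_interior _ `[t m, s m[).
      by apply: nbhs_co; rewrite tr.
    have := dcomm m i j r; rewrite (ltW tr) rs => /(_ isT).
    (* The estimation law is coordinate [(i, j)] of minus the coupling applied to [y - replicate x]:
       the actions cancel in the differences between players. *)
    congr has_derivative_within; rewrite -[RHS]/(est (- _) i j) -[- (_ *m _)]sub0r estB.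
    rewrite est_coupling [est 0 i j]mxE sub0r; congr (- (_ + _)).
      by apply: eq_bigr => k _; rewrite !estB !est_replicate; ring.
    by rewrite estB est_replicate.
  move=> m r /andP[tr rs] rS; have r0 := le_lt_trans (s_ge0 m) tr.
  eexists; last by apply: silent_rate; apply: close; rewrite !ltW.
  apply: is_derive_total_lyapunov => //; first by move=> i; exact: dxi.
  move=> i j; apply: (@has_derivative_within_interior _ `[s m, t m.+1[).
    by apply: nbhs_co; rewrite tr.
  have := dsil m i j r; rewrite (ltW tr) rs => /(_ isT).
  by congr has_derivative_within; rewrite /est mxE.
have S0 : 0 <= (0 : R) <= S by case/andP: tauS => h1 h2; rewrite lexx (le_trans h1).
have /andP[_ W0] := V_bounds (y 0 - replicate (x 0)) (close 0 S0).
have /andP[Wt _] := V_bounds (y tau - replicate (x tau)) (close tau tauS).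
have [Z0 _] := sqr_norm_change (x 0) xs (y 0).
have [_ Zt] := sqr_norm_change (x tau) xs (y tau).
apply: ler_enorm.
  by do 2?apply: mulr_ge0; rewrite ?enorm_ge0 ?expR_ge0 ?(ltW overshoot_gt0).
have overshoot2 : overshoot ^+ 2 = K ^+ 2 * eta2 / eta1 * growth.
  rewrite sqr_sqrtr// mulr_ge0 ?expR_ge0// divr_ge0 ?(ltW eta1_gt0)//.
  by rewrite mulr_ge0 ?sqr_ge0// ltW.
rewrite 2!exprMn overshoot2.
have -> : expR (- (rho / 2) * tau) ^+ 2 = expR (- rho * tau).
  by rewrite expr2 -expRD; congr expR; lra.
apply: (le_trans Zt); rewrite -/K.
apply: (@le_trans _ _ (K * (W tau / eta1))).
  by rewrite ler_pM2l// ler_pdivlMr// mulrC.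
rewrite [leRHS](_ : _ =
    K * (eta2 * (K * z x y 0 ^+ 2) * growth * expR (- rho * tau) / eta1)); last by ring.
rewrite ler_pM2l// ler_pM2r ?invr_gt0//; apply: (le_trans H).
rewrite ler_wpM2r ?expR_ge0// ler_wpM2r ?expR_ge0//; apply: (le_trans W0).
by rewrite ler_pM2l.
Qed.

Lemma intermittent_exponentially_stable :
  exponentially_stable A f kbar eps t s xs (replicate xs).
Proof.
(* The first bound on the initial distance puts the action error below [gamma5] at time 0; the
   second keeps [overshoot] times that distance below [gamma5], as the barrier argument requires. *)
exists (Num.min gamma5 (gamma5 / overshoot)), overshoot, (rho / 2).
split; rewrite ?overshoot_gt0 ?divr_gt0//.
  by rewrite lt_min gamma5_gt0 divr_gt0// overshoot_gt0.
move=> x y sol; rewrite lt_min => /andP[z0 z0'] tau tau0.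
have e_le_z (r : R) : enorm (x r - xs) <= z x y r.
  by apply: ler_enorm; rewrite ?enorm_ge0// enorm_col_mx_sqr lerDl sqr_ge0.
have close (r : R) : 0 <= r -> enorm (x r - xs) < gamma5.
  apply: (@continuous_barrier _ (fun r => enorm (x r - xs))); last 1 first.
  - move=> S S0 closeS; have {}closeS := decay_while_close sol closeS.
    apply: le_lt_trans (e_le_z S) (le_lt_trans (closeS S _) _); first by rewrite S0 lexx.
    apply: (@le_lt_trans _ _ (overshoot * z x y 0)).
      rewrite ler_piMr ?mulr_ge0 ?enorm_ge0 ?(ltW overshoot_gt0)//.
      by rewrite expR_le1 mulNr oppr_le0 !mulr_ge0 ?invr_ge0 ?(ltW rho_gt0).
    by rewrite mulrC -ltr_pdivlMr ?overshoot_gt0.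
  - case: sol => cx _ _ _ _; apply/subspace_continuousP => q q0.
    apply: (@cvg_comp _ _ _ (fun r => x r - xs) enorm _ (nbhs (x q - xs))).
      by apply: cvgB; [move/subspace_continuousP : cx; exact|exact: cvg_cst].
    exact: continuous_enorm.
  - exact: le_lt_trans (e_le_z 0) z0.
apply: (decay_while_close (S := tau) sol); last by rewrite tau0 lexx.
by move=> r /andP[r0 _]; exact: ltW (close r r0).
Qed.

End intermittent_communication.

(** * Equilibrium, choice of [eps], and conclusion *)

Lemma is_equilibrium_stationary (R : realType) (N : nat) (A : 'M[R]_N)
    (f : 'I_N -> 'cV[R]_N -> R) (kbar : 'I_N -> R) (eps : R) (t s : nat -> R)
    (xs : 'cV[R]_N) :
  (forall i, partial i (f i) xs = 0) ->
  is_equilibrium A f kbar eps t s xs (replicate xs).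
Proof.
move=> stat.
have const_deriv (D : set R) (c tau : R) : has_derivative_within D (fun=> c) tau 0.
  rewrite /has_derivative_within (_ : (fun _ => _) = cst 0); first exact: cvg_cst.
  by apply/funext => u; rewrite subrr mul0r.
split.
- by apply: continuous_subspaceT => r; exact: cvg_cst.
- by apply: continuous_subspaceT => r; exact: cvg_cst.
- move=> i tau _; rewrite (_ : est_vec _ i = xs) ?stat ?mulr0//.
  by apply/colP => j; rewrite mxE est_replicate.
- move=> m i j tau _; rewrite !est_replicate subrr mulr0 addr0 big1 ?oppr0// => k _.
  by rewrite !est_replicate subrr mulr0.
- by move=> m i j tau _.
Qed.

(** Ensures that the open interval from which [eps] is drawn is nonempty. *)
Lemma eps_star_gt0 (R : realType) (N : nat) (alpha gamma3 gamma4 : R)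
    (kbar : 'I_N -> R) (P Q : 'M[R]_(N * N)) :
  (0 < N)%N -> posdef P -> posdef Q -> 0 < alpha -> 0 < gamma3 -> 0 < gamma4 ->
  (forall i, 0 < kbar i) -> 0 < eps_star alpha gamma3 gamma4 kbar P Q.
Proof.
move=> N0 Ppos Qpos a0 g3 g4 k0.
have NN0 : (0 < N * N)%N by rewrite muln_gt0 N0.
have P0 := posdef_opnorm_gt0 NN0 Ppos.
have Q0 := posdef_lambda_min_gt0 NN0 Qpos.
have mk0 := max_gain_gt0 N0 k0.
have Nr : 0 < N%:R :> R by rewrite ltr0n.
have p1 : 0 < pi1 alpha gamma4 kbar P.
  by rewrite /pi1 !mulr_gt0// addr_gt0 ?divr_gt0// mulr_gt0.
have p2 : 0 < pi2 alpha kbar P by rewrite /pi2 !mulr_gt0// sqrtr_gt0.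
rewrite /eps_star lt_min; apply/andP; split; apply: divr_gt0.
- exact: mulr_gt0.
- by apply: addr_gt0; [exact: mulr_gt0|exact: exprn_gt0].
- by apply: mulr_gt0; exact: exprn_gt0.
- exact: exprn_gt0.
Qed.

Theorem theorem1 (R : realType) (N : nat) (E : rel 'I_N) (A : 'M[R]_N)
    (P Q : 'M[R]_(N * N)) (f : 'I_N -> 'cV[R]_N -> R) (alpha beta : R)
    (kbar : 'I_N -> R) (xs : 'cV[R]_N) (Vbar : 'cV[R]_N -> R)
    (gamma1 gamma2 gamma3 gamma4 gamma5 eta1 eta2 : R)
    (N_gt0 : (0 < N)%N)
    (E_irrefl : irreflexive E)
    (A_weights : weighted_adjacency E A)
    (E_strong : strongly_connected E)
    (P_diag : is_diag_mx P) (P_pos : posdef P) (Q_pos : posdef Q)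
    (PQ_lyapunov : (coupling A)^T *m P + P *m coupling A = Q)
    (f_C2 : forall i, is_C2 (f i))
    (alpha_gt0 : 0 < alpha) (f_lip : lipschitz_partials f alpha)
    (f_concave : concave_own_action f)
    (beta_gt0 : 0 < beta) (f_mono : strongly_monotone f beta)
    (xs_nash : nash_equilibrium f xs)
    (kbar_gt0 : forall i, 0 < kbar i)
    (Vbar_C1 : is_C1 Vbar)
    (gamma1_gt0 : 0 < gamma1) (gamma2_gt0 : 0 < gamma2)
    (gamma3_gt0 : 0 < gamma3) (gamma4_gt0 : 0 < gamma4)
    (gamma5_gt0 : 0 < gamma5)
    (Vbar_lyapunov :
      local_lyapunov f kbar xs Vbar gamma1 gamma2 gamma3 gamma4 gamma5)
    (eta1_gt0 : 0 < eta1) (eta2_gt0 : 0 < eta2)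
    (V_bounds : forall e ex, enorm e <= gamma5 ->
      eta1 * (enorm e ^+ 2 + enorm ex ^+ 2) <= total_lyapunov P Vbar e ex
        <= eta2 * (enorm e ^+ 2 + enorm ex ^+ 2)) :
  exists eps : R,
    0 < eps < eps_star alpha gamma3 gamma4 kbar P Q /\
    let mu1 := lambda_min (Gamma1 alpha gamma3 gamma4 kbar P Q eps) / eta2 in
    let mu2 := lambda_max (Gamma2 alpha gamma3 gamma4 kbar P eps) / eta1 in
    forall T theta : R,
      0 < T -> 0 < theta < 1 ->
      0 < mu1 * theta - mu2 * (1 - theta) ->
      let t := fun m : nat => m%:R * T in
      let s := fun m : nat => (m%:R + theta) * T in
      is_equilibrium A f kbar eps t s xs (replicate xs) /\
      exponentially_stable A f kbar eps t s xs (replicate xs).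
Proof.
have star_gt0 : 0 < eps_star alpha gamma3 gamma4 kbar P Q by exact: eps_star_gt0.
have stat i : partial i (f i) xs = 0 by exact: nash_stationary.
(* Every value in the open interval would do. *)
exists (eps_star alpha gamma3 gamma4 kbar P Q / 2).
have eps_gt0 := divr_gt0 star_gt0 (ltr0Sn R 1).
split; first by rewrite eps_gt0 ltr_pdivrMr// ltr_pMr// ltr1n.
move=> mu1 mu2 T theta T0 theta01 rho_gt0 t s.
split; first exact: is_equilibrium_stationary.
exact: (intermittent_exponentially_stable N_gt0 P_pos Q_pos PQ_lyapunov alpha_gt0
  f_lip stat kbar_gt0 Vbar_C1 gamma3_gt0 gamma5_gt0 Vbar_lyapunov eta1_gt0 eta2_gt0
  V_bounds eps_gt0 T0 theta01 rho_gt0).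
Qed.
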